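(* If $T$ is a rooted tree with root $r$, then the algorithm ''ESI-number of a tree'' (described in the context) computes $\alpha_{\rm es}(T)$ in $O(n(T))$ time and $O(n(T))$ space.
   Context: All graphs are finite and simple; $n(T)$ is the number of vertices of $T$. For $B\subseteq V(G)$, $N[B]=\bigcup_{b\in B}N[b]$ and $N(B)=N[B]- B$. A set $B\subseteq V(G)$ is an externally supported independence set (ESI-set) if $B$ is independent and every $v\in N(B)$ has a neighbor in $V(G)- N[B]$ (the empty set is an ESI-set); $\alpha_{\rm es}(G)$ is the maximum cardinality of an ESI-set of $G$. For a rooted tree $T$ and $v\in V(T)$, $Ch(v)$ is the set of children of $v$ and $T_v$ the subtree rooted at $v$. Relative to a set $B$, a vertex $v$ has type $S$ if $v\in B$, type $N$ if $v\in N(B)$ and type $R$ if $v\in V(T)-N[B]$. The table entry $DP[v][x][p]$, with $x,p\in\{S,N,R\}$, is intended to be the maximum number of vertices of type $S$ in $T_v$ subject to $v$ having type $x$ and its parent having type $p$; impossible states have value $-\infty$ (and a maximum over no feasible assignment is $-\infty$). Algorithm ''ESI-number of a tree''. Input: a rooted tree $T$ with root $r$. Compute a postorder ordering of the vertices. For every $v$ in postorder compute: (A) ($v$ has type $S$) $DP[v][S][N] = 1+\sum_{u\in Ch(v)} DP[u][N][S]$. (B) ($v$ has type $R$) for each $p\in\{N,R\}$: $DP[v][R][p]=\sum_{u\in Ch(v)}\max\{DP[u][N][R],\,DP[u][R][R]\}$. (C) ($v$ has type $N$) for each $p\in\{S,N,R\}$: $DP[v][N][p]=\max\sum_{u\in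 Ch(v)}DP[u][x_u][N]$, where the maximum is over all assignments $(x_u)_{u\in Ch(v)}$ with $x_u\in\{S,N,R\}$ such that: if $p\neq S$ then at least one child $u$ has $x_u=S$; and if $p\neq R$ then at least one child $u$ has $x_u=R$. Return $\max\{DP[r][S][N],\,DP[r][N][N],\,DP[r][R][N]\}$. *)

(* Defs.v *)
(* MathComp. *)
From HB Require Import structures.
From mathcomp Require Import all_boot all_order all_algebra.
From mathcomp Require Import boolp constructive_ereal.
Set Implicit Arguments.
Unset Strict Implicit.
Unset Printing Implicit Defensive.
Import Order.TTheory GRing.Theory Num.Theory.

Section Graphs.
Variables (T : finType) (e : rel T).

Definition closed_nbhd (B : {set T}) : {set T} :=
  [set v | [exists b in B, (v == b) || e b v]].

Definition open_nbhd (B : {set T}) : {set T} := closed_nbhd B :\: B.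

Definition independent (B : {set T}) : bool :=
  [forall u in B, forall v in B, ~~ e u v].

Definition ESI (B : {set T}) : bool :=
  independent B &&
  [forall v in open_nbhd B, exists w, (w \notin closed_nbhd B) && e v w].

Definition alpha_es : nat := \max_(B : {set T} | ESI B) #|B|.

Definition is_tree : Prop :=
  (forall x y, connect e x y) /\
  (forall c : seq T, 2 < size c -> ~~ (cycle e c && uniq c)).

Variable r : T.

Definition on_root_path (v u : T) : Prop :=
  exists p : seq T,
    [/\ path e r p, uniq (r :: p), last r p = u & v \in r :: p].

Definition children (v : T) : {set T} :=
  [set u | e v u && `[< on_root_path v u >]].

Inductive postorder : T -> seq T -> Prop :=
| Postorder (v : T) (us : seq T) (L : T -> seq T) :
    perm_eq us (enum (children v)) ->
    (forall u, u \in us -> postorder u (L u)) ->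
    postorder v (rcons (flatten [seq L u | u <- us]) v).

End Graphs.

Inductive vtype := tS | tN | tR.

Definition vtype_to_ord (x : vtype) : 'I_3 :=
  match x with tS => inord 0 | tN => inord 1 | tR => inord 2 end.
Definition ord_to_vtype (i : 'I_3) : vtype :=
  match val i with 0 => tS | 1 => tN | _ => tR end.
Lemma vtype_to_ordK : cancel vtype_to_ord ord_to_vtype.
Proof. by case; rewrite /ord_to_vtype /= inordK. Qed.
HB.instance Definition _ := Finite.copy vtype (can_type vtype_to_ordK).

Section Table.
Variables (T : finType) (e : rel T) (r : T).
Let Ch := children e r.
Local Open Scope ereal_scope.

Definition table := T -> vtype -> vtype -> \bar int.

(* The values taken by x outside Ch v are irrelevant. *)
Definition admissible (v : T) (p : vtype) (x : {ffun T -> vtype}) : bool :=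
  ((p != tS) ==> [exists u in Ch v, x u == tS]) &&
  ((p != tR) ==> [exists u in Ch v, x u == tR]).

(* The recurrences, by induction on the height of v, determine D uniquely;
   all values lie in nat or are -oo. *)
Record esi_table (D : table) : Prop := EsiTable {
  esi_table_S : forall v, D v tS tN = 1%:E + \sum_(u in Ch v) D u tN tS;
  esi_table_R : forall v p, p \in [:: tN; tR] ->
    D v tR p = \sum_(u in Ch v) maxe (D u tN tR) (D u tR tR);
  esi_table_N : forall v p,
    D v tN p = \big[maxe/-oo]_(x : {ffun T -> vtype} | admissible v p x)
                  \sum_(u in Ch v) D u (x u) tN;
  esi_table_impossible : forall v,
    [/\ D v tS tS = -oo, D v tS tR = -oo & D v tR tS = -oo] }.

Definition esi_return (D : table) : \bar int :=
  maxe (D r tS tN) (maxe (D r tN tN) (D r tR tN)).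

End Table.

(* A unit-cost random access machine, as a structured language over finitely
   many named arrays of natural-number words.  A scalar variable is an array
   used at index 0 only; inr (x, p) names the array of the DP[_][x][p]. *)
Definition arr : Type := (nat + vtype * vtype)%type.
Definition size_arr : arr := inl 0.
Definition root_arr : arr := inl 1.
Definition off_arr : arr := inl 2.
Definition nbr_arr : arr := inl 3.
Definition order_arr : arr := inl 4.
Definition out_arr : arr := inl 5.
Definition dp_arr (x p : vtype) : arr := inr (x, p).

Definition state := arr -> nat -> nat.

Definition update (st : state) (a : arr) (i w : nat) : state :=
  fun b j => if (b == a) && (j == i) then w else st b j.

Inductive expr :=
| Lit of nat
| Get of arr & expr
| Add of expr & expr
| Sub of expr & expr.

(* While and If test for a nonzero word. *)
Inductive cmd :=
| Skip
| Put of arr & expr & expr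
| Seq of cmd & cmd
| If of expr & cmd & cmd
| While of expr & cmd.

(* One event per elementary operation; the last component is the word produced,
   read or written. *)
Inductive event :=
| Op of nat
| Read of arr & nat & nat
| Write of arr & nat & nat.

Fixpoint eval (st : state) (E : expr) : nat :=
  match E with
  | Lit k => k
  | Get a E1 => st a (eval st E1)
  | Add E1 E2 => eval st E1 + eval st E2
  | Sub E1 E2 => eval st E1 - eval st E2
  end.

Fixpoint events (st : state) (E : expr) : seq event :=
  match E with
  | Lit _ => [:: Op (eval st E)]
  | Get a E1 => rcons (events st E1) (Read a (eval st E1) (eval st E))
  | Add E1 E2 | Sub E1 E2 =>
      rcons (events st E1 ++ events st E2) (Op (eval st E))
  end.

Inductive exec : cmd -> state -> seq event -> state -> Prop :=
| ExecSkip st : exec Skip st [::] st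
| ExecPut st a E1 E2 :
    exec (Put a E1 E2) st
      (rcons (events st E1 ++ events st E2)
             (Write a (eval st E1) (eval st E2)))
      (update st a (eval st E1) (eval st E2))
| ExecSeq c1 c2 st1 st2 st3 t1 t2 :
    exec c1 st1 t1 st2 -> exec c2 st2 t2 st3 ->
    exec (Seq c1 c2) st1 (t1 ++ t2) st3
| ExecIf E c1 c2 st st' t :
    exec (if eval st E != 0 then c1 else c2) st t st' ->
    exec (If E c1 c2) st (events st E ++ t) st'
| ExecWhileStop E c st :
    eval st E = 0 -> exec (While E c) st (events st E) st
| ExecWhileStep E c st1 st2 st3 t1 t2 :
    eval st1 E != 0 ->
    exec c st1 t1 st2 -> exec (While E c) st2 t2 st3 ->
    exec (While E c) st1 (events st1 E ++ t1 ++ t2) st3.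

Definition run_time (t : seq event) : nat := size t.

Definition touched (t : seq event) : seq (arr * nat) :=
  pmap (fun ev => match ev with
                  | Op _ => None
                  | Read a i _ | Write a i _ => Some (a, i)
                  end) t.

(* Each array touched is charged its full extent, up to the largest index. *)
Definition run_space (t : seq event) : nat :=
  \sum_(a <- undup [seq c.1 | c <- touched t])
     \max_(c <- touched t | c.1 == a) c.2.+1.

Definition max_word (t : seq event) : nat :=
  \max_(ev <- t) match ev with Op w | Read _ _ w | Write _ _ w => w end.

Section Input.
Variables (T : finType) (e : rel T) (adj : T -> seq T) (r : T).

Definition adjacency_lists : Prop :=
  forall v, uniq (adj v) /\ (forall u, (u \in adj v) = e v u).

(* Vertices are numbered 0, ..., n - 1. *)
Definition label (v : T) : nat := enum_rank v.

(* The neighbours of the vertex numbered i occupy the cells off[i], ...,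
   off[i+1] - 1 of the array nbr_arr. *)
Definition input_array (a : arr) : seq nat :=
  if a == size_arr then [:: #|T|]
  else if a == root_arr then [:: label r]
  else if a == off_arr then
    [seq \sum_(v <- take i (enum T)) size (adj v) | i <- iota 0 #|T|.+1]
  else if a == nbr_arr then flatten [seq map label (adj v) | v <- enum T]
  else [::].

Definition input : state := fun a i => nth 0 (input_array a) i.

End Input.

Section Log.
Variables (T : finType) (D : table T).

(* -oo is stored as 0 and k as k + 1. *)
Definition code (z : \bar int) : nat :=
  if z is EFin k then (absz k).+1 else 0.

Definition entry_write (v : T) (x p : vtype) : event :=
  Write (dp_arr x p) (label v) (code (D v x p)).

Definition row_writes (v : T) : seq event :=
  [:: entry_write v tS tN;
      entry_write v tR tN; entry_write v tR tR;
      entry_write v tN tS; entry_write v tN tN; entry_write v tN tR].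

Definition order_writes (s : seq T) : seq event :=
  [seq Write order_arr iv.1 (label iv.2) | iv <- zip (iota 0 (size s)) s].

Definition algorithm_log (s : seq T) : seq event :=
  order_writes s ++ flatten [seq row_writes v | v <- s].

End Log.

(* The writes into the ordering and the DP table; all other writes concern
   bookkeeping that the algorithm leaves to its implementation. *)
Definition logged (ev : event) : bool :=
  if ev is Write a _ _ then
    (a == order_arr) || (if a is inr _ then true else false)
  else false.

(* Main.v *)
(* The maximum over the assignments of types to the children of v in (C) is
   computed child by child, by keeping for each of the four combinations of the
   two requirements "some child has type S" and "some child has type R" the best
   sum obtained so far.

   In a tree, every vertex has a unique simple path from the root, so every edge
   joins a parent and a child.  If B is an ESI-set, then typing the vertices by B
   gives table entries which bound, from the leaves up, the number of S-vertices
   in each subtree.  Conversely an optimal root entry is followed from the root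
   down, choosing optimal types for the children of each vertex; the resulting
   S-vertices form an ESI-set.  Hence the returned value is alpha_es.

   A depth-first search with an explicit stack yields a preorder, whose reversal
   is a postorder.  Processing the vertices in that order, the machine completes
   the row of v from accumulators attached to v and then adds that row to the
   accumulators of the parent of v, so no loop over children is needed.  The
   only nested loop, in the search, runs once per entry of the adjacency lists,
   of which there are at most 2n. *)

Require Import Defs.
From mathcomp Require Import all_boot order ssrint constructive_ereal boolp zify.
Set Implicit Arguments.
Unset Strict Implicit.
Unset Printing Implicit Defensive.
Import Order.TTheory.

(** * Table entries as natural numbers *)

Definition vtype_eqb (x y : vtype) : bool :=
  match x, y with tS, tS | tN, tN | tR, tR => true | _, _ => false end.

Lemma vtype_eqE (x y : vtype) : (x == y) = vtype_eqb x y.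
Proof. by case: x y => [] []; apply/eqP. Qed.

(* Addition of extended integers, transported along [uncode]. *)
Definition oadd (a b : nat) : nat :=
  if (a == 0) || (b == 0) then 0 else (a + b).-1.

Definition uncode (k : nat) : \bar int :=
  if k is k'.+1 then EFin (Posz k') else -oo%E.

Lemma uncodeK : cancel uncode Defs.code.
Proof. by case. Qed.

Lemma uncode_oadd a b : uncode (oadd a b) = (uncode a + uncode b)%E.
Proof. by case: a b => [|a] [|b] //; rewrite /oadd /= addnS /= -EFinD -PoszD. Qed.

Lemma uncode_le a b : (uncode a <= uncode b)%E = (a <= b).
Proof. by case: a b => [|a] [|b] //=; rewrite ?lee_fin ?leNye ?leeNy_eq. Qed.

Lemma uncode_max a b : uncode (maxn a b) = maxe (uncode a) (uncode b).
Proof.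
case: (leqP a b) => [ab|/ltnW ba]; first by rewrite (max_idPr _) // uncode_le.
by rewrite (max_idPl _) // uncode_le.
Qed.

Lemma oadd_mono a b c : a <= b -> oadd a c <= oadd b c.
Proof.
case: a b c => [|a] [|b] [|c] //; rewrite /oadd /= !addnS /= !ltnS.
by rewrite leq_add2r.
Qed.

Lemma leq_oadd a b m n : a <= m.+1 -> b <= n.+1 -> oadd a b <= (m + n).+1.
Proof.
case: a b => [|a] [|b] //; rewrite /oadd /= addnS /= !ltnS => *.
exact: leq_add.
Qed.

Lemma foldl_map (A B C : Type) (h : A -> B) (f : C -> B -> C) z s :
  foldl f z (map h s) = foldl (fun a x => f a (h x)) z s.
Proof. by elim: s z => //= x s IHs z. Qed.

(** * Coded table rows, accumulated child by child *)

Definition row : Type := vtype -> vtype -> nat.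

(** The start value 2 codes the number 1, the vertex itself; the start value 1 of [accR] codes 0. *)
Definition accS (ds : seq row) : nat :=
  foldl (fun a d => oadd a (d tN tS)) 2 ds.
Definition accR (ds : seq row) : nat :=
  foldl (fun a d => oadd a (maxn (d tN tR) (d tR tR))) 1 ds.
(* The best sum over type assignments to the children in which S occurs (if nS)
   and R occurs (if nR), extended by one child. *)
Definition accN_step (a : bool -> bool -> nat) (d : row) (nS nR : bool) : nat :=
  maxn (maxn (oadd (a false nR) (d tS tN)) (oadd (a nS false) (d tR tN)))
       (oadd (a nS nR) (d tN tN)).
(** Without children only the empty requirement is feasible, with sum 0 and code 1; the other three
    combinations start at 0, the code of -oo. *)
Definition accN (ds : seq row) : bool -> bool -> nat :=
  foldl accN_step (fun nS nR => ~~ nS && ~~ nR : nat) ds.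

(** A parent of type S or R already supplies a neighbour of that type, so the matching requirement
    on the children is dropped. *)
Definition row_of (ds : seq row) : row := fun x p =>
  match x, p with
  | tS, tN => accS ds
  | tR, tN | tR, tR => accR ds
  | tN, _ => accN ds (match p with tS => false | _ => true end)
                     (match p with tR => false | _ => true end)
  | _, _ => 0
  end.

Lemma uncode_foldl (A : Type) (g : A -> nat) a0 us :
  uncode (foldl (fun a u => oadd a (g u)) a0 us) =
  (uncode a0 + \sum_(u <- us) uncode (g u))%E.
Proof.
elim: us a0 => [|u us IHus] a0; first by rewrite big_nil adde0.
by rewrite /= IHus big_cons uncode_oadd addeA.
Qed.

Section Bounds.
Variables (A : eqType) (d : A -> row) (w : A -> nat).

(** Meant for [w u] the size of the subtree at u; these bounds keep the machine words linear. [accS]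
    gets one more because it counts the vertex itself. *)
Lemma acc_bounds us : (forall u, u \in us -> forall x p, d u x p <= (w u).+1) ->
  [/\ accS (map d us) <= (\sum_(u <- us) w u).+2,
      accR (map d us) <= (\sum_(u <- us) w u).+1 &
      forall nS nR, accN (map d us) nS nR <= (\sum_(u <- us) w u).+1].
Proof.
elim/last_ind: us => [|us u IHus] d_le; first by rewrite big_nil; split=> // -[] [].
have du x p : d u x p <= (w u).+1 by apply: d_le; rewrite mem_rcons mem_head.
have [|S_le R_le N_le] := IHus.
  by move=> v v_us; apply: d_le; rewrite mem_rcons inE v_us orbT.
rewrite map_rcons big_rcons /accS /accR /accN !foldl_rcons /=; split=> [||nS nR].
- by rewrite -addSn; apply: leq_oadd.
- by apply: leq_oadd; rewrite // geq_max !du.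
- by rewrite /accN_step !geq_max !leq_oadd.
Qed.

Lemma row_of_le us x p : (forall u, u \in us -> forall x p, d u x p <= (w u).+1) ->
  row_of (map d us) x p <= (\sum_(u <- us) w u).+2.
Proof.
move=> /acc_bounds[S_le /leqW R_le N_le]; have {}N_le nS nR := leqW (N_le nS nR).
by case: x p => [] [] /=.
Qed.

End Bounds.

Section AccN.
Variables (T : finType) (d : T -> row).

Definition osum (us : seq T) (x : T -> vtype) : nat :=
  foldl oadd 1 [seq d u (x u) tN | u <- us].

Definition meets (us : seq T) (nS nR : bool) (x : T -> vtype) : bool :=
  (nS ==> has (fun u => x u == tS) us) && (nR ==> has (fun u => x u == tR) us).

(** The last child discharges at most the requirement for its own type, and the other children meet
    what is left; each of its three types is one branch of [accN_step]. *)
Lemma meets_accN us nS nR x : meets us nS nR x -> osum us x <= accN (map d us) nS nR.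
Proof.
elim/last_ind: us nS nR => [|us u IHus] nS nR.
  by case/andP; case: nS; case: nR.
rewrite /meets !has_rcons /osum /accN !map_rcons !foldl_rcons => /andP[].
rewrite -/(osum us x) -/(accN _) /accN_step !leq_max.
case xu: (x u); rewrite !vtype_eqE ?implybT /= => xS xR.
- by rewrite (oadd_mono (b := accN (map d us) false nR)) // IHus // /meets xR.
- by rewrite (oadd_mono (b := accN (map d us) nS nR)) ?orbT // IHus // /meets xS.
- by rewrite (oadd_mono (b := accN (map d us) nS false)) ?orbT // IHus // /meets xS.
Qed.

(** Backtracking: the branch attaining the maximum in [accN_step] prescribes the type of the last
    child, and induction supplies the others. The value 0 is excluded because it may stand for an
    empty maximum. *)
Lemma accN_meets us nS nR : uniq us -> accN (map d us) nS nR != 0 ->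
  exists2 x : {ffun T -> vtype}, meets us nS nR x & osum us x = accN (map d us) nS nR.
Proof.
elim/last_ind: us nS nR => [|us u IHus] nS nR.
  by move=> _; exists [ffun=> tN] => //; move: nS nR H => [] [].
rewrite rcons_uniq => /andP[uNus us_uniq].
rewrite /accN map_rcons foldl_rcons -/(accN _).
(* [a] is the type given to the last child, and [nS'], [nR'] are the requirements left to the
   others: an original requirement persists unless [a] discharges it. *)
have ext a nS' nR' : (a == tS) || (nS ==> nS') -> (a == tR) || (nR ==> nR') ->
    oadd (accN (map d us) nS' nR') (d u a tN) != 0 ->
    exists2 x : {ffun T -> vtype}, meets (rcons us u) nS nR x &
      osum (rcons us u) x = oadd (accN (map d us) nS' nR') (d u a tN).
  move=> aS aR; have [->|/IHus[//|x /andP[xS xR] <-] _] :=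
    eqVneq (accN (map d us) nS' nR') 0.
    by rewrite /oadd.
  pose y := [ffun v => if v == u then a else x v].
  have yx : {in us, y =1 x}.
    by move=> v vus; rewrite ffunE; case: eqP => // vu; rewrite -vu vus in uNus.
  have yu : y u = a by rewrite ffunE eqxx.
  have has_y (n n' : bool) b : (a == b) || (n ==> n') ->
      n' ==> has (fun u => x u == b) us -> n ==> has (fun u => y u == b) (rcons us u).
    move=> an /implyP xb; apply/implyP=> n1; rewrite has_rcons yu.
    case/orP: an => [->//|/implyP/(_ n1)/xb/hasP[v vus xv]].
    by apply/orP; right; apply/hasP; exists v; rewrite ?yx.
  exists y; first by rewrite /meets (has_y nS nS' _ aS xS) (has_y nR nR' _ aR xR).
  rewrite /osum map_rcons foldl_rcons yu; congr (oadd (foldl _ _ _) _).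
  by apply/eq_in_map=> v /yx ->.
rewrite /accN_step {1}/maxn; case: ltnP => _; last first.
  by rewrite /maxn; case: ltnP => _; apply: ext; rewrite ?eqxx ?implybb ?orbT.
by apply: ext; rewrite ?implybb ?orbT.
Qed.

End AccN.

(** * The decoded rows satisfy the recurrences (A), (B) and (C) *)

Section DecodeTable.
Variables (T : finType) (e : rel T) (r : T) (kl : T -> seq T) (d : T -> row).
Hypotheses (kl_uniq : forall v, uniq (kl v))
  (mem_kl : forall v u, (u \in kl v) = (u \in children e r v))
  (dE : forall v, d v = row_of (map d (kl v))).

Lemma sum_children (F : T -> \bar int) v :
  (\sum_(u in children e r v) F u = \sum_(u <- kl v) F u)%E.
Proof.
rewrite -big_enum; apply: perm_big; apply: uniq_perm => //; first exact: enum_uniq.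
by move=> u; rewrite mem_enum mem_kl.
Qed.

Lemma uncode_osum v (x : T -> vtype) :
  (\sum_(u in children e r v) uncode (d u (x u) tN))%E = uncode (osum d (kl v) x).
Proof. by rewrite sum_children /osum foldl_map uncode_foldl add0e. Qed.

Lemma admissible_meets v p (x : {ffun T -> vtype}) :
  admissible e r v p x = meets (kl v) (p != tS) (p != tR) x.
Proof.
have has_children a : [exists u in children e r v, x u == a] = has (fun u =>
  x u == a) (kl v).
  by apply/exists_inP/hasP => -[u uv xu]; exists u; rewrite ?mem_kl // -mem_kl.
by rewrite /admissible /meets !has_children.
Qed.

(** In (C), [accN_meets] yields an admissible assignment attaining the accumulated value, and
    [meets_accN] bounds every admissible sum by it. *)
Lemma esi_table_uncode : esi_table e r (fun v x p => uncode (d v x p)).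
Proof.
split=> [v|v p|v p|v]; last by rewrite dE.
- by rewrite sum_children dE /= /accS foldl_map uncode_foldl.
- rewrite !inE !vtype_eqE sum_children dE; case: p => //= _;
  rewrite /accR foldl_map uncode_foldl add0e; apply: eq_bigr => u _;
  exact: uncode_max.
- have -> : d v tN p = accN (map d (kl v)) (p != tS) (p != tR).
    by rewrite dE !vtype_eqE; case: p.
  apply: le_anti; apply/andP; split.
    have [->|/accN_meets[//|x xP <-]] := eqVneq (accN (map d (kl v)) (p != tS) (p != tR)) 0.
      exact: leNye.
    by apply: (bigmax_sup x); rewrite ?admissible_meets // uncode_osum.
  apply: bigmax_le => [|x xP]; first exact: leNye.
  by rewrite uncode_osum uncode_le; apply: meets_accN; rewrite -admissible_meets.
Qed.

End DecodeTable.

(** * Execution of machine programs *)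

Definition arr_eqb (a b : arr) : bool :=
  match a, b with
  | inl i, inl j => eqn i j
  | inr xp, inr yq => vtype_eqb xp.1 yq.1 && vtype_eqb xp.2 yq.2
  | _, _ => false
  end.

Lemma arr_eqE (a b : arr) : (a == b) = arr_eqb a b.
Proof.
case: a b => [i|[x p]] [j|[y q]] //.
have -> : (inr (x, p) == inr (y, q) :> arr) = (x == y) && (p == q) by [].
by rewrite !vtype_eqE.
Qed.

Lemma updateE st a i w b j :
  update st a i w b j = if arr_eqb b a && (j == i) then w else st b j.
Proof. by rewrite /update arr_eqE. Qed.

Arguments update : simpl never.

Fixpoint expr_cost (E : expr) : nat :=
  match E with
  | Lit _ => 1
  | Get _ E1 => (expr_cost E1).+1
  | Add E1 E2 | Defs.Sub E1 E2 => (expr_cost E1 + expr_cost E2).+1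
  end.

Lemma size_events st E : size (events st E) = expr_cost E.
Proof.
by elim: E => [k|a E1 IH1|E1 IH1 E2 IH2|E1 IH1 E2 IH2] //=;
  rewrite size_rcons ?size_cat ?IH1 ?IH2.
Qed.

Lemma events_unlogged st E : [seq ev <- events st E | logged ev] = [::].
Proof.
by elim: E => [k|a E1 IH1|E1 IH1 E2 IH2|E1 IH1 E2 IH2] //=;
  rewrite filter_rcons ?filter_cat /= ?IH1 ?IH2.
Qed.

Definition write_le (M : nat) (ev : event) : bool :=
  if ev is Write _ _ w then w <= M else true.

Lemma events_write_le M st E : all (write_le M) (events st E).
Proof.
by elim: E => [k|a E1 IH1|E1 IH1 E2 IH2|E1 IH1 E2 IH2] //=;
  rewrite all_rcons ?all_cat /= ?IH1 ?IH2.
Qed.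

(** A Hoare triple for total correctness, with a cost and a log. Only written words are bounded by
    [M]; addresses and the words read or computed are bounded later, by [exec_ok]. *)
Definition runs (M : nat) (c : cmd) (st : state) (k : nat) (lg : seq event)
    (Q : state -> Prop) : Prop :=
  exists t st', [/\ exec c st t st', size t <= k, all (write_le M) t,
                    [seq ev <- t | logged ev] = lg & Q st'].

Lemma runs_weaken M c st k k' lg (Q Q' : state -> Prop) :
  runs M c st k lg Q -> k <= k' -> (forall st', Q st' -> Q' st') -> runs M c st k' lg Q'.
Proof.
move=> [t [st' [ex tk wr lgt Qst]]] kk' QQ'; exists t, st'; split=> //.
  exact: leq_trans kk'.
exact: QQ'.
Qed.

Lemma runs_skip M st (Q : state -> Prop) : Q st -> runs M Skip st 0 [::] Q.
Proof. by exists [::], st; split=> //; constructor. Qed.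

Lemma runs_put M a E1 E2 st (Q : state -> Prop) :
  eval st E2 <= M -> Q (update st a (eval st E1) (eval st E2)) ->
  runs M (Put a E1 E2) st (expr_cost E1 + expr_cost E2).+1
    [seq ev <- [:: Write a (eval st E1) (eval st E2)] | logged ev] Q.
Proof.
move=> le_M Qst; do 2!eexists; split; first exact: ExecPut; last exact: Qst.
- by rewrite size_rcons size_cat !size_events.
- by rewrite all_rcons all_cat /= le_M !events_write_le.
- by rewrite filter_rcons filter_cat !events_unlogged; case: ifP => /= ->.
Qed.

Lemma runs_seq M c1 c2 st k1 k2 lg1 lg2 (Q : state -> Prop) :
  runs M c1 st k1 lg1 (fun st' => runs M c2 st' k2 lg2 Q) ->
  runs M (Seq c1 c2) st (k1 + k2) (lg1 ++ lg2) Q.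
Proof.
move=> [t1 [st1 [ex1 k1t wr1 lgt1 [t2 [st2 [ex2 k2t wr2 lgt2 Qst]]]]]].
exists (t1 ++ t2), st2; split=> //; first exact: ExecSeq ex1 ex2.
- by rewrite size_cat leq_add.
- by rewrite all_cat wr1.
- by rewrite filter_cat lgt1 lgt2.
Qed.

(** The list of items still to be handled is both the loop variant and the index of the invariant;
    costs may vary with the item, which gives amortised bounds. *)
Lemma runs_while M (A : Type) (xs : seq A) E c st (cost : A -> nat)
    (lg : A -> seq event) (I : seq A -> state -> Prop) :
  (forall x ys st', I (x :: ys) st' ->
     eval st' E != 0 /\ runs M c st' (cost x) (lg x) (I ys)) ->
  (forall st', I [::] st' -> eval st' E = 0) -> I xs st ->
  runs M (While E c) st
    (\sum_(x <- xs) (cost x + expr_cost E) + expr_cost E)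
    (flatten (map lg xs)) (I [::]).
Proof.
move=> Istep Istop; elim: xs st => [|x xs IHxs] st Ist.
  exists (events st E), st; split=> //; first exact/ExecWhileStop/Istop.
  - by rewrite size_events big_nil.
  - exact: events_write_le.
  - exact: events_unlogged.
have [E0 [t1 [st1 [ex1 k1 wr1 lg1 /IHxs]]]] := Istep x xs st Ist.
move=> [t2 [st2 [ex2 k2 wr2 lg2 Qst]]].
exists (events st E ++ t1 ++ t2), st2; split=> //.
- exact: ExecWhileStep ex1 ex2.
- rewrite !size_cat size_events big_cons [cost x + _]addnC -!addnA leq_add2l.
  exact: leq_add.
- by rewrite !all_cat events_write_le wr1.
- by rewrite !filter_cat events_unlogged lg1 lg2.
Qed.

Definition straight (l : seq (arr * expr * expr)) : cmd :=
  foldr (fun p => Seq (Put p.1.1 p.1.2 p.2)) Skip l.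

Definition straight_cost (l : seq (arr * expr * expr)) : nat :=
  foldr (fun p k => (expr_cost p.1.2 + expr_cost p.2).+1 + k) 0 l.

Definition logged_arr (a : arr) : bool := if a is inl i then eqn i 4 else true.

(** A weakest precondition. Address and word are introduced by equations so that they can be
    rewritten to closed form before they enter the updated state. *)
Fixpoint straight_post (M : nat) (l : seq (arr * expr * expr)) (st : state)
    (lg : seq event) (Q : state -> Prop) : Prop :=
  if l is p :: l' then
    forall i w, i = eval st p.1.2 -> w = eval st p.2 ->
    w <= M /\
    if logged_arr p.1.1 then
      exists lg', lg = Write p.1.1 i w :: lg' /\
        straight_post M l' (update st p.1.1 i w) lg' Q
    else straight_post M l' (update st p.1.1 i w) lg Q
  else lg = [::] /\ Q st.

Lemma straight_post_cons M a E1 E2 l st lg (Q : state -> Prop) i w :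
  ~~ logged_arr a -> eval st E1 = i -> eval st E2 = w -> w <= M ->
  straight_post M l (update st a i w) lg Q ->
  straight_post M ((a, E1, E2) :: l) st lg Q.
Proof. by move=> /negbTE aN <- <- w_le post ? ? -> ->; split; rewrite // aN. Qed.

Lemma runs_straight M l st lg (Q : state -> Prop) :
  straight_post M l st lg Q -> runs M (straight l) st (straight_cost l) lg Q.
Proof.
elim: l st lg => [|[[a E1] E2] l IHl] st lg /=.
  by move=> [-> Qst]; apply: runs_skip.
move=> /(_ _ _ erefl erefl)[leM post].
pose lg1 := [seq ev <- [:: Write a (eval st E1) (eval st E2)] | logged ev].
have [lg' [-> post']] : exists lg', lg = lg1 ++ lg' /\
    straight_post M l (update st a (eval st E1) (eval st E2)) lg' Q.
  rewrite /lg1 /=; case: (a) post => [i|xp]; last first.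
    by rewrite orbT => -[lg' [-> post]]; exists lg'.
  rewrite orbF arr_eqE /=; case: eqn; last by exists lg.
  by move=> [lg' [-> post]]; exists lg'.
by apply: runs_seq; apply: runs_put leM _; apply: IHl.
Qed.

Lemma runs_while_silent M (A : Type) (xs : seq A) E c st (cost : A -> nat)
    (I : seq A -> state -> Prop) :
  (forall x ys st', I (x :: ys) st' ->
     eval st' E != 0 /\ runs M c st' (cost x) [::] (I ys)) ->
  (forall st', I [::] st' -> eval st' E = 0) -> I xs st ->
  runs M (While E c) st
    (\sum_(x <- xs) (cost x + expr_cost E) + expr_cost E) [::] (I [::]).
Proof.
move=> Istep Istop Ist.
have -> : [::] = flatten (map (fun=> [::]) xs) :> seq event by elim: xs {Ist}.
exact: runs_while.
Qed.

Fixpoint written (c : cmd) : seq arr :=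
  match c with
  | Skip => [::]
  | Put a _ _ => [:: a]
  | Seq c1 c2 | If _ c1 c2 => written c1 ++ written c2
  | While _ c1 => written c1
  end.

Definition agree_off (ws : seq arr) (st st' : state) : Prop :=
  forall a i, ~~ has (arr_eqb a) ws -> st' a i = st a i.

Lemma exec_frame c st t st' : exec c st t st' -> agree_off (written c) st st'.
Proof.
elim=> {c st t st'} [st|st a E1 E2|c1 c2 st1 st2 st3 t1 t2 _ IH1 _ IH2
  |E c1 c2 st st' t _ IH|E c st _|E c st1 st2 st3 t1 t2 _ _ IH1 _ IH2] b i //=.
- by rewrite orbF updateE => /negbTE ->.
- by rewrite has_cat negb_or => /andP[b1 b2]; rewrite IH2 // IH1.
- by rewrite has_cat negb_or => /andP[b1 b2]; rewrite IH //; case: ifP.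
- by move=> bN; rewrite IH2 // IH1.
Qed.

Lemma agree_off_refl st : agree_off [::] st st.
Proof. by []. Qed.

Lemma agree_off_update ws st st' a i w :
  agree_off ws st st' -> agree_off (a :: ws) st (update st' a i w).
Proof.
by move=> agree b j /=; rewrite negb_or updateE => /andP[/negbTE -> bN]; apply: agree.
Qed.

Fixpoint reads (E : expr) : seq arr :=
  match E with
  | Lit _ => [::]
  | Get a E1 => a :: reads E1
  | Add E1 E2 | Defs.Sub E1 E2 => reads E1 ++ reads E2
  end.

Lemma eval_agree ws st st' E : agree_off ws st st' ->
  ~~ has (fun a => has (arr_eqb a) ws) (reads E) -> eval st' E = eval st E.
Proof.
move=> agree; elim: E => [k|a E1 IH1|E1 IH1 E2 IH2|E1 IH1 E2 IH2] //=.
- by rewrite negb_or => /andP[aN /IH1 ->]; rewrite agree.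
- by rewrite has_cat negb_or => /andP[/IH1 -> /IH2 ->].
- by rewrite has_cat negb_or => /andP[/IH1 -> /IH2 ->].
Qed.

(** Frame rule: a postcondition has to mention only arrays that the command writes; the rest follows
    from a syntactic check. *)
Lemma runs_frame M c st k lg (Q : state -> Prop) :
  runs M c st k lg Q ->
  runs M c st k lg (fun st' => Q st' /\ agree_off (written c) st st').
Proof.
move=> [t [st' [ex tk wr lgt Qst]]]; exists t, st'; split=> //; split=> //.
exact: exec_frame ex.
Qed.

(** * Word and space bounds read off the program text *)

Section StaticBounds.
Variable (nb_arr : nat).

Definition arr_ok (a : arr) : bool := if a is inl i then i < nb_arr else true.

(** The factor on the cell bound that dominates every word and address met during the evaluation,
    not only the final value; hence [Get] keeps the weight of its address and [Sub] counts both
    operands. *)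
Fixpoint expr_weight (E : expr) : nat :=
  match E with
  | Lit k => k
  | Get _ E1 => (expr_weight E1).+1
  | Add E1 E2 | Defs.Sub E1 E2 => expr_weight E1 + expr_weight E2
  end.

Fixpoint expr_arr_ok (E : expr) : bool :=
  match E with
  | Lit _ => true
  | Get a E1 => arr_ok a && expr_arr_ok E1
  | Add E1 E2 | Defs.Sub E1 E2 => expr_arr_ok E1 && expr_arr_ok E2
  end.

Definition expr_ok (K : nat) (E : expr) : bool := (expr_weight E <= K) && expr_arr_ok E.

Fixpoint cmd_ok (K : nat) (c : cmd) : bool :=
  match c with
  | Skip => true
  | Put a E1 E2 => [&& arr_ok a, expr_ok K E1 & expr_ok K E2]
  | Seq c1 c2 => cmd_ok K c1 && cmd_ok K c2
  | If E c1 c2 => [&& expr_ok K E, cmd_ok K c1 & cmd_ok K c2]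
  | While E c1 => expr_ok K E && cmd_ok K c1
  end.

Definition event_ok (b : nat) (ev : event) : bool :=
  match ev with
  | Op w => w <= b
  | Read a i w | Write a i w => [&& arr_ok a, i <= b & w <= b]
  end.

Lemma event_ok_mono b b' ev : b <= b' -> event_ok b ev -> event_ok b' ev.
Proof.
by move=> bb'; case: ev => [w|a i w|a i w] /=; try (by move/leq_trans; apply);
  move=> /and3P[-> /leq_trans-> // /leq_trans->].
Qed.

Definition cells_le (M : nat) (st : state) : Prop := forall a i, st a i <= M.

Lemma eval_le M st E : 0 < M -> cells_le M st -> eval st E <= expr_weight E * M.
Proof.
move=> M0 stM; elim: E => [k|a E1 IH1|E1 IH1 E2 IH2|E1 IH1 E2 IH2] /=.
- by rewrite leq_pmulr.
- by rewrite mulSn (leq_trans (stM _ _)) // leq_addr.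
- by rewrite mulnDl leq_add.
- by rewrite mulnDl (leq_trans (leq_subr _ _)) // (leq_trans IH1) // leq_addr.
Qed.

Lemma events_ok M st E : 0 < M -> cells_le M st -> expr_arr_ok E ->
  all (event_ok (expr_weight E * M)) (events st E).
Proof.
move=> M0 stM.
have mono w w' t : w <= w' -> all (event_ok (w * M)) t -> all (event_ok (w' * M)) t.
  by move=> ww'; apply: sub_all => ev; apply: event_ok_mono; rewrite leq_mul2r ww' orbT.
elim: E => [k|a E1 IH1|E1 IH1 E2 IH2|E1 IH1 E2 IH2] /=.
- by rewrite leq_pmulr.
- move=> /andP[a_ok /IH1 E1_ok]; rewrite all_rcons (mono _ _ _ _ E1_ok) //= a_ok.
  rewrite mulSn (leq_trans (eval_le E1 M0 stM)) ?leq_addl //=.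
  by rewrite (leq_trans (stM _ _)) // leq_addr.
- move=> /andP[/IH1 E1_ok /IH2 E2_ok]; rewrite all_rcons all_cat /=.
  rewrite (mono _ _ _ _ E1_ok) ?leq_addr // (mono _ _ _ _ E2_ok) ?leq_addl //.
  by rewrite mulnDl leq_add // eval_le.
- move=> /andP[/IH1 E1_ok /IH2 E2_ok]; rewrite all_rcons all_cat /=.
  rewrite (mono _ _ _ _ E1_ok) ?leq_addr // (mono _ _ _ _ E2_ok) ?leq_addl //.
  by rewrite (leq_trans (leq_subr _ _)) // (leq_trans (eval_le _ M0 stM)) // leq_mul2r
    leq_addr orbT.
Qed.

(** Since every write is at most [M], all cells stay below [M] throughout, so each expression is
    always evaluated in a state to which [events_ok] applies. *)
Lemma exec_ok K M c st t st' : 0 < M -> exec c st t st' -> cmd_ok K c ->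
  cells_le M st -> all (write_le M) t ->
  cells_le M st' /\ all (event_ok (K * M)) t.
Proof.
move=> M0.
have expr_le E st1 : expr_ok K E -> cells_le M st1 ->
    eval st1 E <= K * M /\ all (event_ok (K * M)) (events st1 E).
  move=> /andP[EK Eok] st1M; have KM : expr_weight E * M <= K * M
    by rewrite leq_mul2r EK orbT.
  split; first exact: leq_trans (eval_le _ M0 st1M) KM.
  by apply: sub_all (events_ok M0 st1M Eok) => ev; apply: event_ok_mono.
elim=> {c st t st'} [st|st a E1 E2|c1 c2 st1 st2 st3 t1 t2 _ IH1 _ IH2
  |E c1 c2 st st' t _ IH|E c st _|E c st1 st2 st3 t1 t2 _ _ IH1 _ IH2] //=.
- move=> /and3P[a_ok E1K E2K] stM; rewrite all_rcons /= => /andP[le_M _].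
  have [v1 ev1] := expr_le _ _ E1K stM; have [v2 ev2] := expr_le _ _ E2K stM.
  rewrite all_rcons all_cat /= a_ok v1 v2 ev1 ev2; split=> // b j.
  by rewrite updateE; case: ifP.
- move=> /andP[c1K c2K] stM; rewrite !all_cat => /andP[w1 w2].
  have [st2M ->] := IH1 c1K stM w1; exact: IH2.
- move=> /and3P[EK c1K c2K] stM; rewrite !all_cat => /andP[_ w].
  rewrite (expr_le _ _ EK stM).2; apply: IH => //; by case: ifP.
- by move=> /andP[EK _] stM _; rewrite (expr_le _ _ EK stM).2.
- move=> /andP[EK cK] stM; rewrite !all_cat => /and3P[_ w1 w2].
  rewrite (expr_le _ _ EK stM).2; have [st2M ->] := IH1 cK stM w1.
  by apply: IH2; rewrite //= EK.
Qed.

Lemma max_word_le b t : all (event_ok b) t -> max_word t <= b.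
Proof.
rewrite /max_word; elim: t => [|ev t IHt] /=; first by rewrite big_nil.
move=> /andP[ev_ok /IHt]; rewrite big_cons geq_max => ->; rewrite andbT.
by case: ev ev_ok => [w|a i w|a i w] //= /and3P[].
Qed.

(** The 9 counts the arrays [inr (x, p)]; each array touched has extent at most b + 1. *)
Lemma run_space_le b t : all (event_ok b) t -> run_space t <= (nb_arr + 9) * b.+1.
Proof.
move=> t_ok.
have /allP touched_ok : all (fun c => arr_ok c.1 && (c.2 <= b)) (touched t).
  elim: t t_ok => [|ev t IHt] //= /andP[ev_ok /IHt].
  by case: ev ev_ok => [w|a i w|a i w] //= /and3P[-> -> _].
pose As : seq arr := [seq inl i | i <- iota 0 nb_arr] ++
  [seq inr xp | xp <- [seq (x, p) | x <- [:: tS; tN; tR], p <- [:: tS; tN; tR]]].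
rewrite /run_space (leq_trans (n := \sum_(a <- undup [seq c.1 | c <- touched t]) b.+1)) //.
  apply: leq_sum => a _; apply/bigmax_leqP_seq => c /touched_ok /andP[_ cb] _.
  by rewrite ltnS.
rewrite big_const_seq count_predT iter_addn_0 mulnC leq_mul2r /=.
have -> : nb_arr + 9 = size As by rewrite size_cat !size_map size_iota.
apply: uniq_leq_size; first exact: undup_uniq.
move=> a; rewrite mem_undup => /mapP[c /touched_ok /andP[c_ok _] ->].
rewrite mem_cat; case: (c.1) c_ok => [i /= i_lt|[x p] _].
  by rewrite map_f // mem_iota.
by apply/orP; right; apply/map_f; apply/allpairsP; exists (x, p);
  case: x p => [] []; rewrite !inE !vtype_eqE.
Qed.

End StaticBounds.

(** * The program *)

(** [stk_arr] is a stack of height [sp_arr], with the parents of its vertices in [pstk_arr];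
    [pre_arr] and [cnt_arr] hold the preorder found so far and its length. Parents are stored as
    label plus one, with 0 for none, and the accumulators are indexed in the same way. *)
Notation stk_arr := (inl 6 : arr).
Notation pstk_arr := (inl 7 : arr).
Notation sp_arr := (inl 8 : arr).
Notation pre_arr := (inl 9 : arr).
Notation cnt_arr := (inl 10 : arr).
Notation par_arr := (inl 11 : arr).
Notation v_arr := (inl 12 : arr).
Notation i_arr := (inl 13 : arr).
Notation u_arr := (inl 14 : arr).
Notation k_arr := (inl 15 : arr).
Notation p_arr := (inl 16 : arr).
Notation mask_arr := (inl 17 : arr).
Notation accS_arr := (inl 18 : arr).
Notation accR_arr := (inl 19 : arr).
Notation accN00_arr := (inl 20 : arr).
Notation accN10_arr := (inl 21 : arr).
Notation accN01_arr := (inl 22 : arr).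
Notation accN11_arr := (inl 23 : arr).

Definition accN_arr (nS nR : bool) : arr :=
  match nS, nR with
  | false, false => accN00_arr
  | true, false => accN10_arr
  | false, true => accN01_arr
  | true, true => accN11_arr
  end.

Definition Max (E1 E2 : expr) : expr := Add E1 (Defs.Sub E2 E1).
(** With truncated subtraction the inner sum is the distance of the two values, and 1 - (1 - k) is 1
    exactly when k is nonzero. *)
Definition Neq (E1 E2 : expr) : expr :=
  Defs.Sub (Lit 1) (Defs.Sub (Lit 1) (Add (Defs.Sub E1 E2) (Defs.Sub E2 E1))).
(* mask[0] is large and mask[k] = 0 for k > 0: subtracting the masks clears the
   sum as soon as one summand is the code 0 of -oo. *)
Definition Oadd (E1 E2 : expr) : expr :=
  Defs.Sub (Defs.Sub (Add E1 E2) (Lit 1)) (Add (Get mask_arr E1) (Get mask_arr E2)).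

Lemma eval_Max st E1 E2 : eval st (Max E1 E2) = maxn (eval st E1) (eval st E2).
Proof. by rewrite maxnE. Qed.

Lemma eval_Neq st E1 E2 : eval st (Neq E1 E2) = (eval st E1 != eval st E2).
Proof. rewrite /=; case: eqP => /=; lia. Qed.

(** If a summand is 0, the sum less 1 is at most m, and the masks subtract at least m. Otherwise
    both masks are 0. *)
Lemma eval_Oadd m st E1 E2 :
  (forall j, st mask_arr j = if j == 0 then m else 0) ->
  eval st E1 <= m.+1 -> eval st E2 <= m.+1 ->
  eval st (Oadd E1 E2) = oadd (eval st E1) (eval st E2).
Proof.
move=> mask; rewrite /= !mask /oadd.
case: (eval st E1) => [|a]; case: (eval st E2) => [|b] /=; lia.
Qed.


Notation "$ a" := (Get a (Lit 0)) (at level 5, format "$ a").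

(** Arrays outside this list and the input start at 0, which is already right for the counters, for
    the dummy parent of the root in [pstk_arr], and for the three accumulators with a requirement,
    where 0 codes -oo. *)
Definition init_puts : seq (arr * expr * expr) :=
  [:: (mask_arr, Lit 0, Add (Add $size_arr $size_arr) $size_arr);
      (accS_arr, Lit 0, Lit 2); (accR_arr, Lit 0, Lit 1); (accN00_arr, Lit 0, Lit 1);
      (stk_arr, Lit 0, $root_arr); (sp_arr, Lit 0, Lit 1)].

Definition pop_puts : seq (arr * expr * expr) :=
  [:: (sp_arr, Lit 0, Defs.Sub $sp_arr (Lit 1));
      (v_arr, Lit 0, Get stk_arr $sp_arr);
      (par_arr, $v_arr, Get pstk_arr $sp_arr);
      (pre_arr, $cnt_arr, $v_arr);
      (cnt_arr, Lit 0, Add $cnt_arr (Lit 1));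
      (i_arr, Lit 0, Get off_arr $v_arr)].

(* Branch-free push: when u is the parent of v, sp does not move and the cells
   written above the top of the stack are junk. *)
Definition push_puts : seq (arr * expr * expr) :=
  [:: (u_arr, Lit 0, Get nbr_arr $i_arr);
      (stk_arr, $sp_arr, $u_arr);
      (pstk_arr, $sp_arr, Add $v_arr (Lit 1));
      (sp_arr, Lit 0, Add $sp_arr (Neq (Add $u_arr (Lit 1)) (Get par_arr $v_arr)));
      (i_arr, Lit 0, Add $i_arr (Lit 1))].

Definition push_guard : expr := Defs.Sub (Get off_arr (Add $v_arr (Lit 1))) $i_arr.

Definition push_loop : cmd := While push_guard (straight push_puts).

Definition dfs_loop : cmd := While $sp_arr (Seq (straight pop_puts) push_loop).

(** The counter k is used twice: as a position in the ordering and, through k + 1, as the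
    accumulator index of the vertex labelled k. *)
Definition rev_puts : seq (arr * expr * expr) :=
  [:: (order_arr, $k_arr, Get pre_arr (Defs.Sub (Defs.Sub $cnt_arr (Lit 1)) $k_arr));
      (accS_arr, Add $k_arr (Lit 1), Lit 2);
      (accR_arr, Add $k_arr (Lit 1), Lit 1);
      (accN00_arr, Add $k_arr (Lit 1), Lit 1);
      (k_arr, Lit 0, Add $k_arr (Lit 1))].

Definition count_guard : expr := Defs.Sub $size_arr $k_arr.

Definition rev_loop : cmd := While count_guard (straight rev_puts).

(** The writes follow the order of [row_writes]. The first digit of an accumulator name is the
    S-requirement and the second the R-requirement: below a parent of type S only an R-child is
    required, hence [accN01_arr]. *)
Definition row_puts : seq (arr * expr * expr) :=
  [:: (v_arr, Lit 0, Get order_arr $k_arr);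
      (dp_arr tS tN, $v_arr, Get accS_arr (Add $v_arr (Lit 1)));
      (dp_arr tR tN, $v_arr, Get accR_arr (Add $v_arr (Lit 1)));
      (dp_arr tR tR, $v_arr, Get accR_arr (Add $v_arr (Lit 1)));
      (dp_arr tN tS, $v_arr, Get accN01_arr (Add $v_arr (Lit 1)));
      (dp_arr tN tN, $v_arr, Get accN11_arr (Add $v_arr (Lit 1)));
      (dp_arr tN tR, $v_arr, Get accN10_arr (Add $v_arr (Lit 1)));
      (p_arr, Lit 0, Get par_arr $v_arr)].

Definition accN_update (nS nR : bool) : expr :=
  Max (Max (Oadd (Get (accN_arr false nR) $p_arr) (Get (dp_arr tS tN) $v_arr))
           (Oadd (Get (accN_arr nS false) $p_arr) (Get (dp_arr tR tN) $v_arr)))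
      (Oadd (Get (accN_arr nS nR) $p_arr) (Get (dp_arr tN tN) $v_arr)).

(* accN11 is updated first and accN00 last, because each update reads the old
   values with fewer requirements. *)
Definition acc_puts : seq (arr * expr * expr) :=
  [:: (accS_arr, $p_arr, Oadd (Get accS_arr $p_arr) (Get (dp_arr tN tS) $v_arr));
      (accR_arr, $p_arr, Oadd (Get accR_arr $p_arr)
         (Max (Get (dp_arr tN tR) $v_arr) (Get (dp_arr tR tR) $v_arr)));
      (accN11_arr, $p_arr, accN_update true true);
      (accN10_arr, $p_arr, accN_update true false);
      (accN01_arr, $p_arr, accN_update false true);
      (accN00_arr, $p_arr, accN_update false false);
      (k_arr, Lit 0, Add $k_arr (Lit 1))].

Definition row_loop : cmd :=
  While count_guard (Seq (straight row_puts) (straight acc_puts)).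

Definition return_expr : expr :=
  Defs.Sub (Max (Get (dp_arr tS tN) $root_arr)
                (Max (Get (dp_arr tN tN) $root_arr) (Get (dp_arr tR tN) $root_arr)))
           (Lit 1).

Definition esi_program : cmd :=
  Seq (straight init_puts)
 (Seq dfs_loop
 (Seq rev_loop
 (Seq (Put k_arr (Lit 0) (Lit 0))
 (Seq row_loop
      (Put out_arr (Lit 0) return_expr))))).

(** There are 24 arrays of the form [inl i]; 100 is a generous bound on the weights, checked by
    computation. *)
Lemma esi_program_ok : cmd_ok 24 100 esi_program.
Proof. by []. Qed.

Opaque Max Neq Oadd.

(** Cost per vertex: additive constants of a phase are charged to the n >= 1 vertices, and the
    factor 2 stands for the at most 2n adjacency entries. *)
Definition esi_time : nat :=
  straight_cost init_puts +
  ((straight_cost pop_puts + expr_cost push_guard + expr_cost $sp_arr +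
    2 * (straight_cost push_puts + expr_cost push_guard) + expr_cost $sp_arr) +
  ((straight_cost rev_puts + expr_cost count_guard + expr_cost count_guard) +
  (3 +
  ((straight_cost row_puts + straight_cost acc_puts + expr_cost count_guard +
    expr_cost count_guard) + (expr_cost return_expr).+2)))).

(** * Correctness and cost of the program, for an abstract parent map and preorder *)

Section Program.
Variables (T : finType) (adj : T -> seq T) (r : T).
Variables (parent : T -> option T) (pre : T -> seq T) (d : T -> row).
Local Notation n := #|T|.
Local Notation M := (3 * n).
Local Notation kids v := [seq u <- adj v | parent u == Some v].
Local Notation s := (rev (pre r)).

Hypotheses (parent_root : parent r = None)
  (adj_parent : forall v u, u \in adj v -> (parent v == Some u) = (parent u != Some v))
  (preE : forall v, pre v = v :: flatten [seq pre u | u <- rev (kids v)])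
  (pre_perm : perm_eq (pre r) (enum T))
  (sum_adj : \sum_(v <- enum T) size (adj v) <= 2 * n)
  (dE : forall v, d v = row_of [seq d u | u <- s & parent u == Some v])
  (children_before : forall s1 v s2 u,
     s = s1 ++ v :: s2 -> parent u == Some v -> u \in s1)
  (d_le : forall v x p, d v x p <= (size (pre v)).+1)
  (sum_pre : forall o, \sum_(u <- s | parent u == o) size (pre u) <= n).

Local Notation inp := (input adj r).

Lemma n_gt0 : 0 < n.
Proof. by apply/card_gt0P; exists r. Qed.

Lemma leM_n2 k : k <= n.+2 -> k <= M.
Proof. by have := n_gt0; lia. Qed.

Lemma leM_2n k : k <= 2 * n -> k <= M.
Proof. lia. Qed.

Lemma label_lt (v : T) : label v < n.
Proof. exact: ltn_ord. Qed.

Lemma label_leM (v : T) : label v < M.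
Proof. by rewrite (leq_trans (label_lt v)) // leq_pmull. Qed.

Lemma label_inj : injective (@label T).
Proof. by move=> u v /ord_inj/enum_rank_inj. Qed.

Lemma size_pre_n : size (pre r) = n.
Proof. by rewrite (perm_size pre_perm) -cardE. Qed.

Lemma nth_label v0 (v : T) : nth v0 (enum T) (label v) = v.
Proof. exact: nth_enum_rank. Qed.

Opaque label.

Lemma enum_split (v : T) : exists E2, enum T = take (label v) (enum T) ++ v :: E2.
Proof.
exists (drop (label v).+1 (enum T)).
by rewrite -[in LHS](cat_take_drop (label v) (enum T)) (drop_nth v) -?cardE ?label_lt
  // nth_label.
Qed.

Lemma off_array : input_array adj r off_arr =
  [seq \sum_(v <- take i (enum T)) size (adj v) | i <- iota 0 n.+1].
Proof. by rewrite /input_array !arr_eqE. Qed.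

Lemma nbr_array : input_array adj r nbr_arr =
  flatten [seq [seq label u | u <- adj v] | v <- enum T].
Proof. by rewrite /input_array !arr_eqE. Qed.

Lemma inp_off i : i <= n -> inp off_arr i = \sum_(v <- take i (enum T)) size (adj v).
Proof. by move=> i_le; rewrite /input off_array (nth_map 0) ?size_iota // nth_iota. Qed.

Lemma take_labelS (v : T) : take (label v).+1 (enum T) = rcons (take (label v) (enum T)) v.
Proof. by rewrite (take_nth v) ?nth_label // -cardE label_lt. Qed.

Lemma inp_offS (v : T) : inp off_arr (label v).+1 = inp off_arr (label v) + size (adj v).
Proof.
by rewrite !inp_off ?label_lt 1?ltnW ?label_lt // take_labelS big_rcons /= addnC.
Qed.

Lemma inp_nbr (v : T) j : j < size (adj v) ->
  inp nbr_arr (inp off_arr (label v) + j) = label (nth r (adj v) j).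
Proof.
move=> j_lt; rewrite inp_off 1?ltnW ?label_lt //.
rewrite {1}/input nbr_array; have [E2 EE] := enum_split v.
rewrite [in X in nth _ X]EE map_cat flatten_cat nth_cat size_flatten /shape -map_comp.
rewrite sumnE big_map.
have -> A : \sum_(u <- A) (size \o (fun v => [seq label u | u <- adj v])) u =
    \sum_(u <- A) size (adj u) by apply: eq_bigr => u _; rewrite /= size_map.
by rewrite ltnNge leq_addr /= addKn nth_cat size_map j_lt (nth_map r).
Qed.

Lemma inp_off_le i : inp off_arr i <= 2 * n.
Proof.
have [i_le|i_gt] := leqP i n; last first.
  by rewrite /input nth_default // off_array size_map size_iota.
rewrite inp_off // (leq_trans _ sum_adj) // -[in X in _ <= X](cat_take_drop i (enum T)).
by rewrite big_cat leq_addr.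
Qed.

Lemma inp_le a i : inp a i <= M.
Proof.
have n0 := n_gt0; case: (a =P off_arr) => [->|/eqP aN]; first by have := inp_off_le i; lia.
have [|i_ge] := ltnP i (size (input_array adj r a)); last first.
  by rewrite /input nth_default.
rewrite /input /input_array (negbTE aN).
case: ifP => _; first by case: i => //= _; lia.
case: ifP => _; first by case: i => //= _; apply/ltnW/label_leM.
case: ifP => // _ i_lt.
have /flattenP[_ /mapP[v _ ->] /mapP[u _ ->]] := mem_nth 0 i_lt.
exact/ltnW/label_leM.
Qed.

(* Accumulators are indexed by parents; cell 0 serves a dummy parent of r. *)
Definition idx (o : option T) : nat := if o is Some v then (label v).+1 else 0.

Lemma idx_eq o (u : T) : ((label u).+1 == idx o) = (o == Some u).
Proof. by case: o => [v|] //=; rewrite eqSS (inj_eq label_inj) eq_sym. Qed.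

Lemma idx_inj : injective idx.
Proof. by case=> [u|] [v|] //= [/label_inj ->]. Qed.

Lemma idx_le o : idx o <= n.
Proof. by case: o => //= v; exact: label_lt. Qed.

(** The top of the stack is the end of [R]; cells from index [size R] on are unconstrained. *)
Definition stack (R : seq T) (st : state) : Prop :=
  st sp_arr 0 = size R /\
  forall i, i < size R ->
    st stk_arr i = label (nth r R i) /\ st pstk_arr i = idx (parent (nth r R i)).

Definition const_in (st : state) : Prop :=
  forall a i, has (arr_eqb a) [:: size_arr; root_arr; off_arr; nbr_arr] ->
    st a i = inp a i.

Lemma const_in_update st a i w :
  ~~ has (arr_eqb a) [:: size_arr; root_arr; off_arr; nbr_arr] ->
  const_in st -> const_in (update st a i w).
Proof.
move=> aN st_in b j b_in; rewrite updateE -arr_eqE.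
by case: (b =P a) => [ba|_]; [rewrite ba (negbTE aN) in b_in|exact: st_in].
Qed.

(** The invariant splits [adj v] into a scanned prefix and a rest; the children found in the prefix
    lie on the stack above [R]. *)
Lemma push_loop_runs st v R :
  const_in st -> st v_arr 0 = label v -> st i_arr 0 = inp off_arr (label v) ->
  st par_arr (label v) = idx (parent v) -> stack R st -> size (R ++ kids v) <= n ->
  runs M push_loop st
    (size (adj v) * (straight_cost push_puts + expr_cost push_guard) +
     expr_cost push_guard) [::] (stack (R ++ kids v)).
Proof.
move=> st_in st_v st_i st_par st_stack R_le.
pose I (ys : seq T) (st' : state) := exists xs, [/\ adj v = xs ++ ys, const_in st',
  st' v_arr 0 = label v /\ st' i_arr 0 = inp off_arr (label v) + size xs,
  st' par_arr (label v) = idx (parent v) &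
  stack (R ++ [seq u <- xs | parent u == Some v]) st'].
have -> k : size (adj v) * k = \sum_(u <- adj v) k.
  by rewrite big_const_seq count_predT iter_addn_0 mulnC.
apply: runs_weaken (runs_while_silent (I := I) _ _ _) (leqnn _) _.
- move=> u ys st' [xs [adjE st'_in [st'_v st'_i] st'_par [sp_eq stkE]]].
  have offS : st' off_arr (label v + 1) = inp off_arr (label v) + size (adj v).
    by rewrite st'_in // addn1 inp_offS.
  have nbr_u : st' nbr_arr (inp off_arr (label v) + size xs) = label u.
    by rewrite st'_in // inp_nbr adjE ?nth_cat ?ltnn ?subnn // size_cat /= addnS ltnS
      leq_addr.
  split.
    by rewrite /= st'_v st'_i offS adjE size_cat subnDl -lt0n subn_gt0 /= addnS ltnS
      leq_addr.
  have sizeR : size (R ++ [seq u <- xs | parent u == Some v]) <= n.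
    apply: leq_trans R_le; rewrite adjE filter_cat !size_cat leq_add2l.
    exact: leq_addr.
  (* The program only tests whether u is the parent of v; by [adj_parent] all other neighbours are
     children. *)
  have child_u : (label u + 1 != idx (parent v)) = (parent u == Some v).
    rewrite addn1 idx_eq adj_parent ?negbK //.
    by rewrite adjE mem_cat mem_head orbT.
  apply: runs_straight => ? ?; rewrite /= st'_i nbr_u => -> ->.
  split; first exact/ltnW/label_leM.
  move=> ? ?; rewrite ?updateE /= ?sp_eq => -> ->; split; first exact/ltnW/label_leM.
  move=> ? ?; rewrite ?updateE /= ?sp_eq st'_v addn1 => -> ->; split;
    first exact: label_leM.
  move=> ? ?; rewrite eval_Neq /= ?updateE /= ?sp_eq ?st'_v st'_par child_u => -> ->.
  split; first by rewrite leM_n2 // (leq_trans (leq_add sizeR (leq_b1 _))) // addn1.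
  move=> ? ?; rewrite /= ?updateE /= ?st'_i => -> ->; split.
    apply: leM_2n; apply: leq_trans (inp_off_le (label v).+1).
    by rewrite inp_offS adjE size_cat /= -addnA !leq_add2l.
  split=> //.
  exists (rcons xs u); split.
  - by rewrite cat_rcons.
  - by do 5!apply: const_in_update => //.
  - by rewrite ?updateE /= st'_v size_rcons addn1 addnS.
  - by rewrite ?updateE.
  - rewrite /stack ?updateE /= filter_rcons; case: ifP => [/eqP pu|_]; last first.
      rewrite addn0; split=> // j j_lt; rewrite ?updateE /= ltn_eqF //.
      exact: stkE.
    rewrite -rcons_cat size_rcons; split=> [|j]; first by rewrite -addn1.
    rewrite ltnS leq_eqVlt.
    rewrite ?updateE /= nth_rcons => /predU1P[->|j_lt]; last first.
      by rewrite ltn_eqF // j_lt; exact: stkE.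
    by rewrite eqxx ltnn pu.
- move=> st' [xs [adjE st'_in [st'_v st'_i] _ _]].
  rewrite /= st'_v st'_i st'_in // addn1 inp_offS adjE cats0; lia.
- by exists [::]; split=> //; rewrite ?addn0 ?cats0.
- by move=> st' [xs [adjE _ _ _]]; rewrite adjE cats0.
Qed.

Lemma const_in_agree ws st st' : agree_off ws st st' ->
  ~~ has (fun a => has (arr_eqb a) [:: size_arr; root_arr; off_arr; nbr_arr]) ws ->
  const_in st -> const_in st'.
Proof.
move=> agree wsN st_in a i a_in; rewrite agree ?st_in //.
apply: contra wsN => /hasP[b b_ws]; rewrite -arr_eqE => /eqP ab.
by apply/hasP; exists b; rewrite // -ab.
Qed.

Lemma size_flatten_pre R : size R <= size (flatten (map pre R)).
Proof.
elim: R => //= v R IHR; rewrite size_cat -add1n leq_add //.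
by rewrite preE.
Qed.

Definition dfs_done (st : state) : Prop :=
  [/\ st cnt_arr 0 = n, forall i, i < n -> st pre_arr i = label (nth r (pre r) i)
    & forall v, st par_arr (label v) = idx (parent v)].

Lemma mem_pre_r v : v \in pre r.
Proof. by rewrite (perm_mem pre_perm) mem_enum. Qed.

Definition push_cost (v : T) : nat :=
  size (adj v) * (straight_cost push_puts + expr_cost push_guard) +
  expr_cost push_guard.

(** Invariant: the full preorder consists of the visited vertices followed by the preorders of the
    stacked vertices, read from the top. The loop items are the unvisited vertices, so each vertex
    pays once for its own adjacency list. *)
Lemma dfs_loop_runs st :
  const_in st -> st cnt_arr 0 = 0 -> stack [:: r] st ->
  runs M dfs_loop st
    (\sum_(v <- pre r) (straight_cost pop_puts + push_cost v + expr_cost $sp_arr) +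
     expr_cost $sp_arr) [::] dfs_done.
Proof.
move=> st_in st_cnt st_stack.
pose I (ys : seq T) (st' : state) := exists L R,
  [/\ pre r = L ++ ys, ys = flatten (map pre (rev R)), const_in st' & stack R st'] /\
  [/\ st' cnt_arr 0 = size L,
      forall i, i < size L -> st' pre_arr i = label (nth r L i) &
      forall v, v \in L -> st' par_arr (label v) = idx (parent v)].
apply: runs_weaken (runs_while_silent
  (cost := fun v => straight_cost pop_puts + push_cost v) (I := I) _ _ _) (leqnn _) _.
- move=> x ys st' [L [R [[preLR ysE st'_in [sp_eq stkE]] [cntE preLE parE]]]].
  case/lastP: R => [|R0 v] // in ysE sp_eq stkE *.
  (* Popping v and pushing its children unfolds [preE] once; the child pushed last is visited first,
     which is why [preE] reverses the children. *)
  have [xE {}ysE] : x = v /\ ys = flatten (map pre (rev (R0 ++ kids v))).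
    by move: ysE; rewrite rev_cat map_cat flatten_cat rev_rcons /= preE => -[].
  rewrite xE in preLR *.
  rewrite size_rcons in sp_eq stkE.
  have [stk_v pstk_v] := stkE _ (ltnSn (size R0)).
  rewrite nth_rcons ltnn eqxx in stk_v pstk_v.
  have L_lt : size L < n by rewrite -size_pre_n preLR size_cat /= addnS ltnS leq_addr.
  (* Each stacked vertex heads a nonempty block of unvisited vertices, so the stack never exceeds
     n. *)
  have R_le : size (R0 ++ kids v) <= n.
    have R_ys : size (R0 ++ kids v) <= size ys.
      by rewrite ysE -[size (_ ++ _)]size_rev size_flatten_pre.
    apply: leq_trans R_ys _; rewrite -size_pre_n preLR size_cat /= addnS.
    by rewrite leqW ?leq_addl.
  split; first by rewrite /= sp_eq.
  apply: (runs_seq (lg1 := [::]) (lg2 := [::])).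

  apply: runs_straight => ? ?; rewrite /= sp_eq => -> ->; rewrite subn1 /=.
  split; first by apply: leM_n2; rewrite size_cat in R_le; do 2!apply: leqW;
    apply: leq_trans R_le; apply: leq_addr.
  move=> ? ?; rewrite ?updateE /= ?sp_eq ?stk_v => -> ->; split; first exact/ltnW/label_leM.
  move=> ? ?; rewrite ?updateE /= ?sp_eq ?stk_v ?pstk_v => -> ->.
  split; first by rewrite leM_n2 // (leq_trans (idx_le _)) // leqW.
  move=> ? ?; rewrite ?updateE /= ?cntE => -> ->; split; first exact/ltnW/label_leM.
  move=> ? ?; rewrite ?updateE /= ?cntE addn1 => -> ->; split; first
    by rewrite leM_n2 // leqW // ltnW.
  move=> ? ?; rewrite ?updateE /= ?st'_in // => -> ->.
  split; first exact: leM_2n (inp_off_le _).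
  split=> //.
  set st1 := update _ _ _ _.
  have st1_in : const_in st1 by do 6!apply: const_in_update => //.
  have st1_stack : stack R0 st1.
    split=> [|i i_lt]; rewrite /st1 ?updateE //=.
    by have := stkE i (ltnW i_lt); rewrite nth_rcons i_lt.
  apply: runs_weaken (runs_frame (push_loop_runs st1_in _ _ _ st1_stack R_le)) (leqnn _) _.
  + by rewrite /st1 ?updateE.
  + by rewrite /st1 ?updateE.
  + by rewrite /st1 ?updateE /= eqxx.
  move=> st2 [st2_stack st2_agree].
  exists (rcons L v), (R0 ++ kids v); split; split=> //.
  + by rewrite cat_rcons.
  + exact: const_in_agree st2_agree _ st1_in.
  + by rewrite st2_agree // /st1 ?updateE size_rcons.
  + move=> i; rewrite st2_agree // /st1 ?updateE /= size_rcons nth_rcons ltnS leq_eqVlt.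
    move=> /predU1P[->|i_lt]; first by rewrite ltnn eqxx.
    by rewrite i_lt ltn_eqF // preLE.
  + move=> u; rewrite st2_agree // /st1 ?updateE /= mem_rcons inE (inj_eq label_inj).
    by case: eqP => [->|_ /parE].
- move=> st' [L [R [[_ ysE _ [sp_eq _]] _]]]; rewrite /= sp_eq.
  by case/lastP: R ysE {sp_eq} => // R v; rewrite rev_rcons /= preE.
- exists [::], [:: r]; split; split=> //=.
  by rewrite cats0.
- move=> st' [L [R [[preLR _ _ _] [cntE preLE parE]]]]; rewrite cats0 in preLR.
  rewrite -preLR size_pre_n in cntE preLE parE.
  by split=> // v; apply: parE; exact: mem_pre_r.
Qed.

Lemma size_s : size s = n.
Proof. by rewrite size_rev size_pre_n. Qed.

Definition acc_init (j : nat) (st : state) : Prop :=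
  [/\ st accS_arr j = 2, st accR_arr j = 1 & st accN00_arr j = 1].

(** After k rounds the accumulator cells 0, ..., k hold their start values: cell 0 was filled at
    initialisation, so n rounds cover all n + 1 indices. *)
Lemma rev_loop_runs st :
  dfs_done st -> st size_arr 0 = n -> st k_arr 0 = 0 -> acc_init 0 st ->
  runs M rev_loop st
    (n * (straight_cost rev_puts + expr_cost count_guard) + expr_cost count_guard)
    (order_writes s)
    (fun st' => (forall i, i < n -> st' order_arr i = label (nth r s i)) /\
       forall j, j <= n -> acc_init j st').
Proof.
move=> [st_cnt st_pre _] st_n st_k st_acc.
pose I (ys : seq (nat * T)) (st' : state) := exists s1 s2,
  [/\ s = s1 ++ s2, ys = zip (iota (size s1) (size s2)) s2, st' k_arr 0 = size s1,
      forall i, i < size s1 -> st' order_arr i = label (nth r s i) &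
      forall j, j <= size s1 -> acc_init j st'] /\
  [/\ st' cnt_arr 0 = n, st' size_arr 0 = n &
      forall i, i < n -> st' pre_arr i = label (nth r (pre r) i)].
pose lg (iv : nat * T) := [:: Write order_arr iv.1 (label iv.2)].
have -> : order_writes s = flatten (map lg (zip (iota 0 (size s)) s)).
  by rewrite /order_writes; elim: (zip _ _) => //= iv ivs ->.
have -> k : n * k = \sum_(iv <- zip (iota 0 (size s)) s) k.
  rewrite big_const_seq count_predT iter_addn_0 mulnC size_zip size_iota minnn.
  by rewrite size_s.
apply: runs_weaken (runs_while (lg := lg) (I := I) _ _ _) (leqnn _) _.
- move=> iv ys st' [s1 [s2 [[sE ysE k_eq orderE accE] [cntE nE preE']]]].
  case: s2 => [|x s2] // in sE ysE *.
  have k_lt : size s1 < n by rewrite -size_s sE size_cat /= addnS ltnS leq_addr.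
  have -> : iv = (size s1, x) by case: ysE.
  have {}ysE : ys = zip (iota (size s1).+1 (size s2)) s2 by case: ysE.
  have pre_x : st' pre_arr (n - 1 - size s1) = label x.
    rewrite -subnDA add1n preE' ?ltn_subrL ?n_gt0 //; congr label.
    rewrite -size_pre_n -nth_rev ?size_pre_n // sE nth_cat ltnn subnn //.
  split; first by rewrite /= nE k_eq subn_eq0 -ltnNge.
  apply: runs_straight => ? ?; rewrite /= k_eq cntE pre_x => -> ->.
  split; first exact/ltnW/label_leM.
  exists [::]; split=> //.
  move=> ? ?; rewrite ?updateE /= ?k_eq ?addn1 => -> ->; split; first exact: leM_n2.
  move=> ? ?; rewrite ?updateE /= ?k_eq ?addn1 => -> ->; split; first by apply: leM_n2.
  move=> ? ?; rewrite ?updateE /= ?k_eq ?addn1 => -> ->; split; first by apply: leM_n2.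
  move=> ? ?; rewrite ?updateE /= ?k_eq ?addn1 => -> ->; split.
    by apply: leM_n2; do 2!apply: leqW.
  split=> //.
  exists (rcons s1 x), s2; split; split=> //.
  + by rewrite cat_rcons.
  + by rewrite size_rcons.
  + by rewrite ?updateE size_rcons.
  + move=> i; rewrite ?updateE /= size_rcons ltnS leq_eqVlt => /predU1P[->|i_lt].
      by rewrite eqxx sE nth_cat ltnn subnn.
    by rewrite ltn_eqF // orderE.
  + move=> j; rewrite /acc_init ?updateE /= size_rcons leq_eqVlt => /predU1P[->|j_le].
      by rewrite eqxx.
    by rewrite ltn_eqF //; apply: accE.
- move=> st' [s1 [s2 [[sE ysE k_eq _ _] [_ nE _]]]].
  case: s2 => [|x s2] // in sE ysE *.
  by rewrite /= nE k_eq -size_s sE cats0 subnn.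
- exists [::], s; split; split=> //.
  by move=> j; rewrite leqn0 => /eqP ->.
- move=> st' [s1 [s2 [[sE ysE k_eq orderE accE] _]]].
  case: s2 => [|x s2] // in sE ysE *; rewrite cats0 in sE.
  by rewrite -sE size_s in orderE accE.
Qed.

(** What the accumulators with index [idx o] have absorbed once the vertices of [s1] are
    processed. *)
Definition child_rows (s1 : seq T) (o : option T) : seq row :=
  [seq d u | u <- s1 & parent u == o].

Lemma child_rows_rcons s1 v o : child_rows (rcons s1 v) o =
  if parent v == o then rcons (child_rows s1 o) (d v) else child_rows s1 o.
Proof. by rewrite /child_rows filter_rcons; case: ifP; rewrite ?map_rcons. Qed.

(** All children of v precede it in the ordering and none follows, so the accumulators of v are
    complete when its turn comes. *)
Lemma child_rows_split s1 v s2 : s = s1 ++ v :: s2 -> d v = row_of (child_rows s1 (Some v)).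
Proof.
move=> sE; rewrite dE sE filter_cat; congr (row_of (map d _)).
have : uniq s by rewrite rev_uniq (perm_uniq pre_perm) enum_uniq.
rewrite sE cat_uniq => /and3P[_ /hasPn dis _].
have -> : [seq u <- v :: s2 | parent u == Some v] = [::]; last by rewrite cats0.
rewrite -(filter_pred0 (v :: s2)); apply: eq_in_filter => u /dis.
by apply: contraNF => /(children_before sE).
Qed.

(** The subtrees of siblings have together at most n vertices, so partially filled accumulators are
    bounded as well. *)
Lemma acc_le s1 s2 o : s = s1 ++ s2 ->
  [/\ accS (child_rows s1 o) <= n.+2, accR (child_rows s1 o) <= n.+1 &
      forall nS nR, accN (child_rows s1 o) nS nR <= n.+1].
Proof.
move=> sE; have le_n : \sum_(u <- s1 | parent u == o) size (pre u) <= n.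
  by apply: leq_trans (sum_pre o); rewrite sE big_cat leq_addr.
rewrite -big_filter in le_n.
have [S_le R_le N_le] := acc_bounds (us := [seq u <- s1 | parent u == o]) (fun u _ =>
  d_le u).
split=> [||nS nR]; [exact: leq_trans S_le _|exact: leq_trans R_le _|].
exact: leq_trans (N_le nS nR) _.
Qed.

Lemma row_le v x p : d v x p <= n.+1.
Proof.
(* The subtree of v is one of the summands in [sum_pre] for the parent of v. *)
apply: leq_trans (d_le v x p) _; rewrite ltnS (leq_trans _ (sum_pre (parent v))) //.
by rewrite (big_rem v) ?mem_rev ?mem_pre_r //= eqxx leq_addr.
Qed.

Local Notation D := (fun v x p => uncode (d v x p)).

Definition row_stored (v : T) (st : state) : Prop :=
  [/\ forall x, st (dp_arr x tN) (label v) = d v x tN,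
      st (dp_arr tR tR) (label v) = d v tR tR,
      st (dp_arr tN tS) (label v) = d v tN tS &
      st (dp_arr tN tR) (label v) = d v tN tR].

Lemma row_puts_runs st s1 v s2 :
  s = s1 ++ v :: s2 -> st k_arr 0 = size s1 -> st order_arr (size s1) = label v ->
  st par_arr (label v) = idx (parent v) ->
  st accS_arr (label v).+1 = accS (child_rows s1 (Some v)) ->
  st accR_arr (label v).+1 = accR (child_rows s1 (Some v)) ->
  (forall nS nR, st (accN_arr nS nR) (label v).+1 = accN (child_rows s1 (Some v)) nS nR) ->
  runs M (straight row_puts) st (straight_cost row_puts) (row_writes D v)
    (fun st' => [/\ st' v_arr 0 = label v, st' p_arr 0 = idx (parent v), row_stored v st' &
       forall u x, u != v -> st' (dp_arr x tN) (label u) = st (dp_arr x tN) (label u)]).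
Proof.
move=> sE st_k st_order st_par st_S st_R st_N.
have dv := child_rows_split sE.
have {}st_S : st accS_arr (label v).+1 = d v tS tN by rewrite st_S dv.
have {}st_R : st accR_arr (label v).+1 = d v tR tN by rewrite st_R dv.
have RR : d v tR tR = d v tR tN by rewrite dv.
have st_N01 : st accN01_arr (label v).+1 = d v tN tS by rewrite (st_N false true) dv.
have st_N11 : st accN11_arr (label v).+1 = d v tN tN by rewrite (st_N true true) dv.
have st_N10 : st accN10_arr (label v).+1 = d v tN tR by rewrite (st_N true false) dv.
have dM x p : d v x p <= M by apply: leM_n2; apply/leqW/row_le.
have entryE x p : entry_write D v x p = Write (dp_arr x p) (label v) (d v x p).
  by rewrite /entry_write uncodeK.
rewrite /row_writes !entryE RR.
apply: runs_straight => ? ?; rewrite /= st_k st_order => -> ->.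
split; first exact/ltnW/label_leM.
move=> ? ?; rewrite ?updateE /= ?addn1 ?st_S => -> ->; split=> //.
eexists; split; first reflexivity.
move=> ? ?; rewrite ?updateE /= ?addn1 ?st_R => -> ->; split=> //.
eexists; split; first reflexivity.
move=> ? ?; rewrite ?updateE /= ?addn1 ?st_R => -> ->; split=> //.
eexists; split; first reflexivity.
move=> ? ?; rewrite ?updateE /= ?addn1 ?st_N01 => -> ->; split=> //.
eexists; split; first reflexivity.
move=> ? ?; rewrite ?updateE /= ?addn1 ?st_N11 => -> ->; split=> //.
eexists; split; first reflexivity.
move=> ? ?; rewrite ?updateE /= ?addn1 ?st_N10 => -> ->; split=> //.
eexists; split; first reflexivity.
move=> ? ?; rewrite ?updateE /= ?st_par => -> ->; split.
  by rewrite leM_n2 // (leq_trans (idx_le _)) // leqW.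
split=> //; split; rewrite ?updateE //.
  by split=> [x| | |]; rewrite ?RR ?updateE /= ?eqxx //; case: x; rewrite ?updateE /= ?eqxx.
move=> u x uv; have ne : (label u == label v) = false
  by rewrite (inj_eq label_inj) (negbTE uv).
by rewrite ?updateE /= ne ?andbF; case: x.
Qed.

Lemma acc_puts_runs st s1 v s2 :
  s = s1 ++ v :: s2 -> st k_arr 0 = size s1 ->
  (forall j, st mask_arr j = if j == 0 then M else 0) ->
  st v_arr 0 = label v -> st p_arr 0 = idx (parent v) -> row_stored v st ->
  (forall o, st accS_arr (idx o) = accS (child_rows s1 o)) ->
  (forall o, st accR_arr (idx o) = accR (child_rows s1 o)) ->
  (forall o nS nR, st (accN_arr nS nR) (idx o) = accN (child_rows s1 o) nS nR) ->
  runs M (straight acc_puts) st (straight_cost acc_puts) [::]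
    (fun st' => [/\ st' k_arr 0 = (size s1).+1,
      forall o, st' accS_arr (idx o) = accS (child_rows (rcons s1 v) o),
      forall o, st' accR_arr (idx o) = accR (child_rows (rcons s1 v) o) &
      forall o nS nR, st' (accN_arr nS nR) (idx o) = accN (child_rows (rcons s1 v) o)
        nS nR]).
Proof.
move=> sE st_k st_mask st_v st_p [dN dRR dNS dNR] st_S st_R st_N.
have sE' : s = rcons s1 v ++ s2 by rewrite cat_rcons.
have [S_le R_le N_le] := acc_le (parent v) sE.
have [S_le' R_le' N_le'] := acc_le (parent v) sE'.
rewrite child_rows_rcons eqxx /accS /accR /accN !foldl_rcons -/(accS _) -/(accR _) in
  S_le' R_le' N_le'.
have leM k : k <= n.+2 -> k <= M.+1 by move=> /leM_n2/leqW.
have N00 o : st accN00_arr (idx o) = accN (child_rows s1 o) false false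
  by exact: (st_N o false false).
have N10 o : st accN10_arr (idx o) = accN (child_rows s1 o) true false
  by exact: (st_N o true false).
have N01 o : st accN01_arr (idx o) = accN (child_rows s1 o) false true
  by exact: (st_N o false true).
have N11 o : st accN11_arr (idx o) = accN (child_rows s1 o) true true
  by exact: (st_N o true true).
have dS := dN tS; have dR := dN tR; have {}dN := dN tN; rewrite /= in dS dR dN.
have row_leM x p : d v x p <= M.+1 by apply: leM; apply/leqW/row_le.
have S_leM := leM _ S_le; have R_leM := leM _ (leqW R_le).
have N_leM nS nR := leM _ (leqW (N_le nS nR)).
set o := parent v in st_p S_leM R_leM N_leM S_le' R_le' N_le' *.
pose wS := oadd (accS (child_rows s1 o)) (d v tN tS).
pose wR := oadd (accR (child_rows s1 o)) (maxn (d v tN tR) (d v tR tR)).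
pose wN := accN_step (accN (child_rows s1 o)) (d v).
have max_leM k l : k <= M.+1 -> l <= M.+1 -> maxn k l <= M.+1 by rewrite geq_max => -> ->.
have evS : eval st (Oadd (Get accS_arr $p_arr) (Get (dp_arr tN tS) $v_arr)) = wS.
  by rewrite (eval_Oadd st_mask) /= ?st_p ?st_v ?st_S ?dNS.
have evR : eval st (Oadd (Get accR_arr $p_arr)
    (Max (Get (dp_arr tN tR) $v_arr) (Get (dp_arr tR tR) $v_arr))) = wR.
  by rewrite (eval_Oadd st_mask) ?eval_Max /= ?st_p ?st_v ?st_R ?dNR ?dRR // max_leM.
(* All values are computed in the initial state [st]; the facts [agree2] to [agree5] below transfer
   them, since each assignment reads only arrays not yet overwritten. *)
have evN nS nR : eval st (accN_update nS nR) = wN nS nR.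
  case: nS; case: nR; rewrite /accN_update !eval_Max !(eval_Oadd st_mask) /= ?st_p ?st_v;
    by rewrite ?N00 ?N01 ?N10 ?N11 ?dS ?dR ?dN.
have wN_le nS nR : wN nS nR <= M by apply: leM_n2; apply: leqW.
apply: runs_straight; rewrite /acc_puts.
apply: (straight_post_cons (i := idx o) (w := wS)) => //; first exact: leM_n2.
set st1 := update st _ _ _.
have agree1 : agree_off [:: accS_arr] st st1 by exact/agree_off_update/agree_off_refl.
apply: (straight_post_cons (i := idx o) (w := wR)) => //.
  by apply: leM_n2; apply: leqW.
set st2 := update st1 _ _ _.
have agree2 : agree_off [:: accR_arr; accS_arr] st st2 by exact: agree_off_update.
apply: (straight_post_cons (i := idx o) (w := wN true true)) => //.
  by rewrite (eval_agree agree2) ?evN //; vm_compute.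
set st3 := update st2 _ _ _.
have agree3 : agree_off [:: accN11_arr; accR_arr; accS_arr] st st3
  by exact: agree_off_update.
apply: (straight_post_cons (i := idx o) (w := wN true false)) => //.
  by rewrite (eval_agree agree3) ?evN //; vm_compute.
set st4 := update st3 _ _ _.
have agree4 : agree_off [:: accN10_arr; accN11_arr; accR_arr; accS_arr] st st4.
  exact: agree_off_update.
apply: (straight_post_cons (i := idx o) (w := wN false true)) => //.
  by rewrite (eval_agree agree4) ?evN //; vm_compute.
set st5 := update st4 _ _ _.
have agree5 : agree_off [:: accN01_arr; accN10_arr; accN11_arr; accR_arr; accS_arr] st st5.
  exact: agree_off_update.
apply: (straight_post_cons (i := idx o) (w := wN false false)) => //.
  by rewrite (eval_agree agree5) ?evN //; vm_compute.
set st6 := update st5 _ _ _.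
apply: (straight_post_cons (i := 0) (w := (size s1).+1)) => //.
- by rewrite /= /st6 !updateE /= agree5 // st_k addn1.
- by apply: leM_n2; rewrite -size_s sE size_cat /=; do 2!apply: leqW;
    rewrite addnS ltnS leq_addr.
split=> //.
(* Only the accumulators of the parent of v absorb a new row; injectivity of [idx] protects all
   others. *)
have accE (A : Type) (F : seq row -> A) o' : F (child_rows (rcons s1 v) o') =
    (if o == o' then F (rcons (child_rows s1 o') (d v)) else F (child_rows s1 o')).
  by rewrite child_rows_rcons; case: ifP.
rewrite /st6 /st5 /st4 /st3 /st2 /st1.
split=> [|o'|o'|o' nS nR]; rewrite ?updateE //=.
- rewrite (accE _ accS) st_S (inj_eq idx_inj) eq_sym /accS foldl_rcons.
  by case: eqP => // <-.
- rewrite (accE _ accR) st_R (inj_eq idx_inj) eq_sym /accR foldl_rcons.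
  by case: eqP => // <-.
- rewrite (accE _ (fun ds => accN ds nS nR)) /accN foldl_rcons -!/(accN _).
  by case: nS; case: nR; rewrite ?updateE /= ?N00 ?N01 ?N10 ?N11 (inj_eq idx_inj) eq_sym;
    case: eqP => // <-.
Qed.

(** Invariant: for every possible parent, the dummy one included, the accumulators are the folds
    over the rows of its children processed so far. *)
Lemma row_loop_runs st :
  st size_arr 0 = n -> st k_arr 0 = 0 ->
  (forall i, i < n -> st order_arr i = label (nth r s i)) ->
  (forall v, st par_arr (label v) = idx (parent v)) ->
  (forall j, st mask_arr j = if j == 0 then M else 0) ->
  (forall j, j <= n -> acc_init j st) ->
  (forall nS nR j, nS || nR -> st (accN_arr nS nR) j = 0) ->
  runs M row_loop st
    (n * (straight_cost row_puts + straight_cost acc_puts + expr_cost count_guard) +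
     expr_cost count_guard)
    (flatten [seq row_writes D v | v <- s])
    (fun st' => forall v x, st' (dp_arr x tN) (label v) = d v x tN).
Proof.
move=> st_n st_k st_order st_par st_mask st_acc st_N.
pose I (ys : seq T) (st' : state) := exists s1,
  [/\ s = s1 ++ ys /\ st' k_arr 0 = size s1,
      forall o, st' accS_arr (idx o) = accS (child_rows s1 o),
      forall o, st' accR_arr (idx o) = accR (child_rows s1 o),
      forall o nS nR, st' (accN_arr nS nR) (idx o) = accN (child_rows s1 o) nS nR &
      forall v x, v \in s1 -> st' (dp_arr x tN) (label v) = d v x tN] /\
  [/\ st' size_arr 0 = n, forall i, i < n -> st' order_arr i = label (nth r s i),
      forall v, st' par_arr (label v) = idx (parent v) &
      forall j, st' mask_arr j = if j == 0 then M else 0].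
have -> k : n * k = \sum_(v <- s) k.
  by rewrite big_const_seq count_predT iter_addn_0 mulnC size_s.
apply: runs_weaken (runs_while (lg := fun v => row_writes D v) (I := I) _ _ _) (leqnn _) _.
- move=> v s2 st' [s1 [[[sE k_eq] S_eq R_eq N_eq dpE] [nE orderE parE maskE]]].
  have s1_lt : size s1 < n by rewrite -size_s sE size_cat /= addnS ltnS leq_addr.
  have sE' : s = rcons s1 v ++ s2 by rewrite cat_rcons.
  split; first by rewrite /= nE k_eq subn_eq0 -ltnNge.
  rewrite -[row_writes D v]cats0; apply: runs_seq.
  have order_v : st' order_arr (size s1) = label v.
    by rewrite orderE // sE nth_cat ltnn subnn.
  apply: runs_weaken (runs_frame (row_puts_runs sE k_eq order_v (parE v)
    (S_eq (Some v)) (R_eq (Some v)) (N_eq (Some v)))) (leqnn _) _.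
  move=> st1 [[v_eq p_eq stored old] agree1].
  apply: runs_weaken (runs_frame (acc_puts_runs sE _ _ v_eq p_eq stored _ _ _)) (leqnn _) _.
  + by rewrite agree1.
  + by move=> j; rewrite agree1.
  + by move=> o; rewrite agree1.
  + by move=> o; rewrite agree1.
  + by move=> o nS nR; rewrite agree1 //; case: nS nR => [] [].
  move=> st2 [[k_eq2 S_eq2 R_eq2 N_eq2] agree2].
  exists (rcons s1 v); split; split=> //.
  + by rewrite size_rcons.
  + move=> u x; rewrite mem_rcons inE agree2 //.
    have [-> _|uv /= us1] := eqVneq u v; first by have [-> _ _ _] := stored.
    by rewrite old // dpE.
  + by rewrite agree2 // agree1.
  + by move=> i i_lt; rewrite agree2 // agree1 // orderE.
  + by move=> u; rewrite agree2 // agree1.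
  + by move=> j; rewrite agree2 // agree1.
- move=> st' [s1 [[[sE k_eq] _ _ _ _] [nE _ _ _]]].
  by rewrite /= nE k_eq -size_s sE cats0 subnn.
- exists [::]; split; split=> // [o|o|o nS nR].
  + by have [-> _ _] := st_acc _ (idx_le o).
  + by have [_ -> _] := st_acc _ (idx_le o).
  (* The accumulators with a requirement must start at -oo, that is at 0, which these still
     untouched arrays contain. *)
  + case nSR: (nS || nR); first by rewrite st_N //; case: nS nR nSR => [] [].
    by case: nS nR nSR => [] [] // _; have [_ _ ->] := st_acc _ (idx_le o).
- move=> st' [s1 [[[sE k_eq] _ _ _ dpE] _]] v x; rewrite cats0 in sE.
  by apply: dpE; rewrite -sE mem_rev mem_pre_r.
Qed.

Lemma inp_zero a i :
  ~~ has (arr_eqb a) [:: size_arr; root_arr; off_arr; nbr_arr] -> inp a i = 0.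
Proof.
rewrite /= !negb_or => /and5P[a0 a1 a2 a3 _].
by rewrite /input /input_array !arr_eqE (negbTE a0) (negbTE a1) (negbTE a2) (negbTE a3)
  nth_nil.
Qed.

Definition init_done (st : state) : Prop :=
  [/\ const_in st, st cnt_arr 0 = 0, stack [:: r] st, acc_init 0 st &
  [/\ st k_arr 0 = 0, forall j, st mask_arr j = if j == 0 then M else 0 &
      forall nS nR j, nS || nR -> st (accN_arr nS nR) j = 0]].

Lemma init_puts_runs :
  runs M (straight init_puts) inp (straight_cost init_puts) [::] init_done.
Proof.
have inp_n : inp size_arr 0 = n by rewrite /input /input_array arr_eqE.
have inp_r : inp root_arr 0 = label r by rewrite /input /input_array !arr_eqE.
apply: runs_straight; rewrite /init_puts.
apply: (straight_post_cons (i := 0) (w := M)) => //.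
  by rewrite /= inp_n !mulSn mul0n addn0 addnA.
apply: (straight_post_cons (i := 0) (w := 2)) => //; first exact: leM_n2.
apply: (straight_post_cons (i := 0) (w := 1)) => //; first exact: leM_n2.
apply: (straight_post_cons (i := 0) (w := 1)) => //; first exact: leM_n2.
apply: (straight_post_cons (i := 0) (w := label r)) => //.
  exact/ltnW/label_leM.
apply: (straight_post_cons (i := 0) (w := 1)) => //; first exact: leM_n2.
split=> //; split.
- by do 6!apply: const_in_update => //.
- by rewrite ?updateE inp_zero.
- by split=> [|[|j]] //; rewrite ?updateE //= inp_zero // parent_root.
- by split; rewrite ?updateE.
- split=> [|j|nS nR j nSR]; first by rewrite ?updateE inp_zero.
    by rewrite ?updateE /=; case: eqP => // _; rewrite inp_zero.
  by case: nS nR nSR => [] [] // _; rewrite ?updateE inp_zero.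
Qed.

Definition esi_program_cost : nat :=
  straight_cost init_puts +
  ((\sum_(v <- pre r) (straight_cost pop_puts + push_cost v + expr_cost $sp_arr) +
    expr_cost $sp_arr) +
  ((n * (straight_cost rev_puts + expr_cost count_guard) + expr_cost count_guard) +
  (3 +
  ((n * (straight_cost row_puts + straight_cost acc_puts + expr_cost count_guard) +
    expr_cost count_guard) +
   (expr_cost return_expr).+2)))).

Lemma esi_program_runs :
  runs M esi_program inp esi_program_cost
    (order_writes s ++ flatten [seq row_writes D v | v <- s])
    (fun st => st out_arr 0 =
       (maxn (d r tS tN) (maxn (d r tN tN) (d r tR tN))).-1).
Proof.
apply: (runs_seq (lg1 := [::])).
apply: runs_weaken init_puts_runs (leqnn _) _.
move=> st0 [in0 cnt0 stack0 acc0 [k0 mask0 N0]].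
apply: (runs_seq (lg1 := [::])).
apply: runs_weaken (runs_frame (dfs_loop_runs in0 cnt0 stack0)) (leqnn _) _.
move=> st1 [done1 agree1]; have [_ _ par1] := done1.
have in1 : const_in st1 by exact: const_in_agree agree1 _ in0.
apply: runs_seq.
have n1 : st1 size_arr 0 = n by rewrite in1.
have k1 : st1 k_arr 0 = 0 by rewrite agree1.
have acc1 : acc_init 0 st1 by rewrite /acc_init !agree1.
apply: runs_weaken (runs_frame (rev_loop_runs done1 n1 k1 acc1)) (leqnn _) _.
move=> st2 [[order2 acc2] agree2].
have in2 : const_in st2 by exact: const_in_agree agree2 _ in1.
apply: (runs_seq (lg1 := [::])); apply: (runs_put (E1 := Lit 0) (E2 := Lit 0)) => //.
rewrite -[X in runs _ _ _ _ X]cats0; apply: runs_seq.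
set st3 := update _ _ _ _.
have agree3 : agree_off [:: k_arr] st2 st3 by exact/agree_off_update/agree_off_refl.
have in3 : const_in st3 by exact: const_in_agree agree3 _ in2.
apply: runs_weaken (runs_frame (row_loop_runs (st := st3) _ _ _ _ _ _ _)) (leqnn _) _.
- by rewrite in3.
- by rewrite /st3 updateE.
- by move=> i i_lt; rewrite agree3 // order2.
- by move=> v; rewrite agree3 // agree2.
- by move=> j; rewrite agree3 // agree2 // agree1.
- by move=> j j_le; rewrite /acc_init !agree3 //; apply: acc2.
- move=> nS nR j nSR; rewrite agree3 ?agree2 ?agree1 ?N0 //;
    by case: nS nR nSR => [] [].
move=> st4 [dp4 agree4].
have root4 : st4 root_arr 0 = label r by rewrite agree4 // in3.
have return4 : eval st4 return_expr =
    (maxn (d r tS tN) (maxn (d r tN tN) (d r tR tN))).-1.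
  by rewrite /return_expr /= !eval_Max /= root4 !dp4 subn1.
apply: (runs_put (M := M) (a := out_arr) (E1 := Lit 0) (E2 := return_expr)).
  rewrite return4; apply: leM_n2; apply: leq_trans (leq_pred _) _.
  by apply: leqW; rewrite !geq_max !row_le.
by rewrite return4 updateE.
Qed.

Lemma esi_program_cost_le : esi_program_cost <= esi_time * n.
Proof.
have cost_le k : k <= k * n by rewrite leq_pmulr ?n_gt0.
have dfs_le : \sum_(v <- pre r) (straight_cost pop_puts + push_cost v + expr_cost
  $sp_arr) <=
    (straight_cost pop_puts + expr_cost push_guard + expr_cost $sp_arr +
     2 * (straight_cost push_puts + expr_cost push_guard)) * n.
  set a := straight_cost pop_puts; set b := expr_cost push_guard.
  set c := expr_cost $sp_arr; set q := straight_cost push_puts + b.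
  (* Separate the cost per visited vertex from the cost per adjacency entry; the latter is summed by
     [sum_adj]. *)
  rewrite (eq_bigr (fun v => (a + b + c) + size (adj v) * q)) => [|v _].
    rewrite big_split /= big_const_seq count_predT iter_addn_0 size_pre_n -big_distrl /=.
    by rewrite [X in _ <= X]mulnDl leq_add2l mulnAC leq_mul2r (perm_big _ pre_perm)
      sum_adj orbT.
  by rewrite /push_cost -/q -/b [_ * q + b]addnC addnA addnAC.
rewrite /esi_program_cost /esi_time mulnDl leq_add // mulnDl leq_add //.
  by rewrite mulnDl leq_add.
rewrite mulnDl leq_add //; first by rewrite mulnDl leq_add // mulnC.
rewrite mulnDl leq_add // mulnDl leq_add //.
by rewrite mulnDl leq_add // mulnC.
Qed.

End Program.

(** * Rooted trees *)

Section SimplePaths.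
Variables (T : finType) (e : rel T).
Hypotheses (esym : symmetric e)
  (eacyclic : forall c : seq T, 2 < size c -> ~~ (cycle e c && uniq c)).

(** Otherwise a simple path from y to z avoiding x closes up through x to a cycle of length at least
    3. *)
Lemma acyclic_neighbours x y z p :
  e x y -> e x z -> path e y p -> last y p = z -> x \notin y :: p -> y = z.
Proof.
move=> xy xz /shortenP[q yq uq sq] lq xp.
case: q => [|a q] in yq uq sq lq *; first exact: lq.
have xq : x \notin [:: y, a & q].
  apply: contra xp; rewrite inE => /predU1P[->|/sq xp]; first exact: mem_head.
  by rewrite inE xp orbT.
have /negP[] := @eacyclic [:: x, y, a & q] isT; rewrite cons_uniq xq uq andbT.
by move: yq lq; rewrite /cycle rcons_path /= xy => -> ->; rewrite esym xz.
Qed.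

Lemma simple_path_unique x p q :
  path e x p -> uniq (x :: p) -> path e x q -> uniq (x :: q) ->
  last x p = last x q -> p = q.
Proof.
elim: p x q => [|y p IHp] x [|z q] //.
- by move=> _ _ _ /andP[/negP xq _] /= xl; case: xq; rewrite [x in x \in _]xl mem_last.
- by move=> _ /andP[/negP xp _] _ _ /= xl; case: xp; rewrite -[x in x \in _]xl mem_last.
move=> /= /andP[xy yp] /and3P[xp yNp up] /andP[xz zq] /and3P[xq zNq uq] lpq.
have yz : y = z.
  (* Follow p from y to the common end, then q backwards to z; this walk avoids x. *)
  apply: (@acyclic_neighbours x y z (p ++ rev (belast z q))) => //.
  - rewrite cat_path yp lpq rev_path.
    by rewrite (@eq_path _ _ e) // => a b; rewrite /= esym.
  - rewrite last_cat lpq; case: q {xq zNq uq lpq zq} => [|a q] //=.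
    by rewrite rev_cons last_rcons.
  - rewrite -cat_cons mem_cat negb_or xp mem_rev.
    by apply: contra xq; apply: mem_belast.
by rewrite yz in yp yNp lpq *; rewrite (IHp z q) //= ?yNp ?zNq.
Qed.

End SimplePaths.

Section RootedTree.
Variables (T : finType) (e : rel T) (r : T).
Hypotheses (esym : symmetric e) (eirr : irreflexive e) (etree : is_tree e).

Variable rpath : T -> seq T.
Hypothesis rpathP : forall u,
  [/\ path e r (rpath u), uniq (r :: rpath u) & last r (rpath u) = u].

Local Notation Ch := (children e r).

Lemma rpath_unique u p :
  path e r p -> uniq (r :: p) -> last r p = u -> rpath u = p.
Proof.
have [pu uu lu] := rpathP u => pp up lp.
by apply: (simple_path_unique esym etree.2 pu uu pp up); rewrite lu.
Qed.

(** Replaces the existence of a root path through v by an equation between the chosen root paths,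
    from which depth and uniqueness of parents are read off. *)
Lemma childP v u : reflect (e v u /\ rpath u = rcons (rpath v) u) (u \in Ch v).
Proof.
have [pv uv lv] := rpathP v; have [pu uu lu] := rpathP u.
apply: (iffP idP) => [|[vu Pu]]; rewrite inE; last first.
  rewrite vu; apply/asboolP; exists (rpath u); split=> //.
  by rewrite Pu -rcons_cons mem_rcons inE -[X in X \in r :: _]lv mem_last orbT.
move=> /andP[vu /asboolP[p [pp up lp vp]]]; split=> //.
rewrite (rpath_unique pp up lp).
(* Cut the root path of u at v: the first part is the root path of v, and the second joins v to u,
   so by uniqueness it is the single edge. *)
case/splitPl: vp => p1 p2 lp1 in pp up lp *.
move: pp up; rewrite cat_path -cat_cons cat_uniq lp1 => /andP[pp1 pp2].
case/and3P=> up1 dis up2; rewrite (rpath_unique pp1 up1 lp1) -cats1.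
congr (_ ++ _); apply: (simple_path_unique esym etree.2 pp2) => /=.
- rewrite up2 andbT; apply: contraNN dis => vp2; apply/hasP; exists v => //.
  by rewrite -lp1 mem_last.
- by rewrite vu.
- by rewrite inE andbT; apply: contraTneq vu => ->; rewrite eirr.
- by rewrite -lp last_cat lp1.
Qed.

(** Either u lies on the root path of v, or appending u to that path gives the root path of u. *)
Lemma edge_child v u : e v u -> (u \in Ch v) || (v \in Ch u).
Proof.
have [pv uv lv] := rpathP v => vu.
case: (boolP (u \in r :: rpath v)) => [uv'|uNv].
  rewrite orbC inE esym vu; apply/orP; left; apply/asboolP.
  by exists (rpath v).
apply/orP; left; apply/childP; split=> //; apply: rpath_unique.
- by rewrite rcons_path pv lv.
- by rewrite -rcons_cons rcons_uniq uNv.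
- by rewrite last_rcons.
Qed.

Lemma child_edge v u : u \in Ch v -> e v u.
Proof. by case/childP. Qed.

Lemma child_depth v u : u \in Ch v -> size (rpath u) = (size (rpath v)).+1.
Proof. by case/childP=> _ ->; rewrite size_rcons. Qed.

Lemma child_asym v u : u \in Ch v -> v \notin Ch u.
Proof.
move=> /child_depth uv; apply/negP => /child_depth; rewrite uv => /eqP.
by rewrite -[X in X == _]addn0 -addn2 eqn_add2l.
Qed.

Lemma parent_unique u v w : u \in Ch v -> u \in Ch w -> v = w.
Proof.
case/childP=> _ Pu /childP[_]; rewrite Pu => /rcons_inj[vw].
by have [_ _ <-] := rpathP v; have [_ _ <-] := rpathP w; rewrite vw.
Qed.

Lemma root_not_child v : r \notin Ch v.
Proof.
by apply/negP=> /childP[_]; rewrite (@rpath_unique r [::]) //; case: (rpath v).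
Qed.

Lemma parent_ex u : u != r -> exists v, u \in Ch v.
Proof.
have [pu uu lu] := rpathP u => ur.
case Pu: (rpath u) lu => [|a p] lu; first by rewrite -lu eqxx in ur.
move: Pu lu; rewrite lastI; move: (belast a p) (last a p) => q w Pu lu.
move: pu uu lu; rewrite Pu rcons_path last_rcons -rcons_cons rcons_uniq.
move=> /andP[pq qw] /andP[_ uq] wu; exists (last r q); apply/childP.
by rewrite (@rpath_unique (last r q) q) // Pu -wu qw.
Qed.

Lemma depth_lt u : size (rpath u) < #|T|.
Proof. by have [_ /card_uniqP/= <- _] := rpathP u; apply: max_card. Qed.

(** Root paths are simple, so depths stay below n, and n minus the depth decreases towards the
    children. *)
Lemma leaf_up_ind (Q : T -> Prop) :
  (forall v, (forall u, u \in Ch v -> Q u) -> Q v) -> forall v, Q v.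
Proof.
move=> IH v; have [k] := ubnP (#|T| - size (rpath v)).
elim: k v => // k IHk v lek; apply: IH => u uv; apply: IHk.
by rewrite (child_depth uv) subnS prednK ?subn_gt0 ?depth_lt.
Qed.

Lemma root_down_ind (Q : T -> Prop) :
  Q r -> (forall v u, u \in Ch v -> Q v -> Q u) -> forall v, Q v.
Proof.
move=> Qr IH v; have [k] := ubnP (size (rpath v)); elim: k v => // k IHk v lek.
have [->//|/parent_ex[w vw]] := eqVneq v r.
by apply: (IH w) => //; apply: IHk; rewrite -(child_depth vw) -ltnS.
Qed.

(** Recursion over children by iteration: the value at u is stable after n minus the depth of u
    rounds, so the n-th iterate is a fixed point. It provides both the preorder and the rows. *)
Lemma child_rec (A : Type) (F : (T -> A) -> T -> A) (a0 : A) :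
  (forall f g v, (forall u, u \in Ch v -> f u = g u) -> F f v = F g v) ->
  exists f, forall v, f v = F f v.
Proof.
move=> Fext; pose f k := iter k F (fun=> a0); exists (f #|T|) => v.
suff: forall k u, #|T| - size (rpath u) <= k -> f k u = f k.+1 u.
  by apply; rewrite leq_subr.
elim=> [|k IHk] u.
  by rewrite leqn0 subn_eq0 leqNgt depth_lt.
move=> le_k; apply: Fext => w wu; apply: IHk.
by rewrite (child_depth wu) subnS -ltnS prednK ?subn_gt0 ?depth_lt // (leq_trans _ le_k).
Qed.


Definition parent (u : T) : option T := [pick v | u \in Ch v].

Lemma parentE u v : (parent u == Some v) = (u \in Ch v).
Proof.
rewrite /parent; case: pickP => [w uw|/(_ v) ->] //.
by apply/eqP/idP => [[<-]|/(parent_unique uw) ->].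
Qed.

Lemma parent_root : parent r = None.
Proof. by rewrite /parent; case: pickP => // v; rewrite (negbTE (root_not_child v)). Qed.

(** * The depth-first preorder and the size of the adjacency lists *)

Variable adj : T -> seq T.
Hypothesis adjP : adjacency_lists e adj.

Definition kids (v : T) : seq T := [seq u <- adj v | u \in Ch v].

Lemma mem_kids v u : (u \in kids v) = (u \in Ch v).
Proof.
rewrite mem_filter (adjP v).2 andb_idr // => /child_edge; exact.
Qed.

Lemma kids_uniq v : uniq (kids v).
Proof. exact/filter_uniq/(adjP v).1. Qed.

(** A neighbour that is not a child has v as its child, and v has at most one parent. *)
Lemma size_adj v : size (adj v) <= (size (kids v)).+1.
Proof.
rewrite -(count_predC (mem (Ch v)) (adj v)) size_filter -addn1 leq_add2l.
rewrite -size_filter; set q := filter _ _.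
have qP a : a \in q -> v \in Ch a.
  rewrite mem_filter (adjP v).2 => /andP[/= aNv /edge_child].
  by rewrite (negbTE aNv).
have: uniq q by exact/filter_uniq/(adjP v).1.
case: q qP => [|a [|b q]] //= qP /andP[/negP[]]; rewrite inE.
by rewrite (@parent_unique v a b) ?qP ?inE ?eqxx ?orbT.
Qed.

Variable pre : T -> seq T.
Hypothesis preE : forall v, pre v = v :: flatten [seq pre u | u <- rev (kids v)].

Lemma mem_pre v w :
  reflect (w = v \/ exists2 u, u \in Ch v & w \in pre u) (w \in pre v).
Proof.
rewrite preE inE; apply: (iffP predU1P) => -[->|]; try by left.
  by move=> /flattenP[_ /mapP[u + ->] wu]; rewrite mem_rev mem_kids; right; exists u.
move=> [u uv wu]; right; apply/flattenP; exists (pre u) => //; apply/map_f.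
by rewrite mem_rev mem_kids.
Qed.

Lemma pre_child w v u : v \in pre w -> u \in Ch v -> u \in pre w.
Proof.
elim/leaf_up_ind: w => w IHw /mem_pre[-> uw|[x xw vx] uv]; apply/mem_pre; right.
  by exists u => //; apply/mem_pre; left.
by exists x => //; apply: IHw.
Qed.

Lemma pre_total w : w \in pre r.
Proof.
elim/root_down_ind: w => [|v u uv vr]; first by apply/mem_pre; left.
exact: pre_child uv.
Qed.

Lemma pre_prefix v w : w \in pre v -> prefix (rpath v) (rpath w).
Proof.
elim/leaf_up_ind: v => v IHv /mem_pre[->|[u uv wu]]; first exact: prefix_refl.
apply: prefix_trans (IHv u uv wu); have /childP[_ ->] := uv.
exact: prefix_rcons.
Qed.

(** The root paths of u1 and u2 are prefixes of equal length of the root path of w. *)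
Lemma pre_disjoint v u1 u2 w :
  u1 \in Ch v -> u2 \in Ch v -> w \in pre u1 -> w \in pre u2 -> u1 = u2.
Proof.
move=> u1v u2v /pre_prefix + /pre_prefix; rewrite !prefixE.
rewrite (child_depth u1v) (child_depth u2v) => /eqP -> /eqP.
by have /childP[_ ->] := u1v; have /childP[_ ->] := u2v => /rcons_inj[].
Qed.

Lemma depth_pre v w : w \in pre v -> size (rpath v) <= size (rpath w).
Proof. by move/pre_prefix/size_prefix. Qed.

(** Distinctness and the precedence of parents come from one induction: v is shallower than all
    vertices below it, and the blocks of different children are disjoint and closed under taking
    children. *)
Lemma pre_pairwise v : pairwise (fun a b => (a != b) && (a \notin Ch b)) (pre v).
Proof.
elim/leaf_up_ind: v => v IHv; rewrite preE pairwise_cons; apply/andP; split.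
  apply/allP=> b /flattenP[_ /mapP[u + ->]]; rewrite mem_rev mem_kids => uv.
  move=> /depth_pre; rewrite (child_depth uv) => ltvb; apply/andP; split.
    by apply: contraTneq ltvb => ->; rewrite ltnn.
  by apply: contraTN ltvb => /child_depth ->; rewrite -leqNgt leqnSn.
have: uniq (rev (kids v)) by rewrite rev_uniq kids_uniq.
have: {subset rev (kids v) <= Ch v} by move=> u; rewrite mem_rev mem_kids.
elim: (rev _) => //= u l IHl sub /andP[ul ulist].
have uv : u \in Ch v by rewrite sub ?mem_head.
have lv : {subset l <= Ch v} by move=> x xl; rewrite sub ?inE ?xl ?orbT.
rewrite pairwise_cat IHv // IHl // !andbT.
apply/allrelP=> a b au /flattenP[_ /mapP[x xl ->] bx].
have uNx w : w \in pre u -> w \in pre x -> False.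
  by move=> wu wx; rewrite (pre_disjoint uv (lv x xl) wu wx) xl in ul.
apply/andP; split; first by apply/eqP=> ab; apply: (uNx b) => //; rewrite -ab.
by apply/negP=> /(pre_child bx)/(uNx a au).
Qed.

Lemma pre_uniq v : uniq (pre v).
Proof.
rewrite uniq_pairwise; apply: sub_pairwise (pre_pairwise v) => a b /andP[].
by [].
Qed.

Lemma pre_perm : perm_eq (pre r) (enum T).
Proof.
apply: uniq_perm; rewrite ?pre_uniq ?enum_uniq // => w.
by rewrite mem_enum pre_total.
Qed.

Lemma size_pre_root : size (pre r) = #|T|.
Proof. by rewrite (perm_size pre_perm) -cardE. Qed.

Lemma size_pre v : size (pre v) = (\sum_(u <- kids v) size (pre u)).+1.
Proof.
rewrite preE /= size_flatten /shape -map_comp sumnE big_map.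
by rewrite (perm_big (kids v)) // perm_rev.
Qed.

(** Every vertex of the subtree except v is counted once, as a child of its parent. *)
Lemma sum_kids v : (\sum_(w <- pre v) size (kids w)).+1 = size (pre v).
Proof.
elim/leaf_up_ind: v => v IHv; rewrite size_pre {1}preE big_cons; congr _.+1.
rewrite big_flatten big_map (perm_big (kids v)) ?perm_rev //.
rewrite -sum1_size -big_split /=; apply: eq_big_seq => u.
by rewrite mem_kids => /IHv <-.
Qed.

Lemma sum_size_adj : \sum_(v <- enum T) size (adj v) <= 2 * #|T|.
Proof.
rewrite mul2n -addnn -[X in _ <= X + _]size_pre_root -sum_kids -(perm_big _ pre_perm) /=.
apply: (@leq_trans (\sum_(v <- pre r) ((size (kids v)) + 1))).
  by apply: leq_sum => v _; rewrite addn1 size_adj.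
by rewrite big_split sum1_size /= size_pre_root leq_add2r leqnSn.
Qed.

(** Reversal moves v to the end and undoes the reversal of the children in [preE]. *)
Lemma postorder_pre v : postorder e r v (rev (pre v)).
Proof.
elim/leaf_up_ind: v => v IHv; rewrite preE rev_cons rev_flatten -map_comp.
rewrite -map_rev revK.
have -> : map (rev \o pre) (kids v) = [seq rev (pre u) | u <- kids v] by [].
apply: (Postorder (L := rev \o pre)) => [|u].
  apply: uniq_perm; rewrite ?kids_uniq ?enum_uniq // => u.
  by rewrite mem_kids mem_enum.
by rewrite mem_kids => /IHv.
Qed.

Lemma children_before s1 v s2 u :
  rev (pre r) = s1 ++ v :: s2 -> u \in Ch v -> u \in s1.
Proof.
move=> sE uv; have: u \in s1 ++ v :: s2 by rewrite -sE mem_rev pre_total.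
rewrite mem_cat => /orP[//|]; rewrite inE => /predU1P[uv'|us2].
  by move: (child_asym uv); rewrite uv' in uv *; rewrite uv.
have := pre_pairwise r; rewrite -[pre r]revK sE rev_cat rev_cons cat_rcons.
rewrite pairwise_cat => /andP[/allrelP/(_ u v)]; rewrite mem_rev us2.
by rewrite mem_head uv andbF => /(_ isT isT).
Qed.


(** Fold along the root path, carrying the current vertex together with its value. *)
Lemma root_down_rec (A : Type) (F : T -> A -> T -> A) (a0 : A) :
  exists g, g r = a0 /\ forall v u, u \in Ch v -> g u = F v (g v) u.
Proof.
pose G := foldl (fun wa u => (u, F wa.1 wa.2 u)) (r, a0).
exists (fun u => (G (rpath u)).2); split.
  by rewrite (@rpath_unique r [::]).
have G1 p : (G p).1 = last r p by elim/last_ind: p => // p x _;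
  rewrite /G foldl_rcons last_rcons.
move=> v u /childP[_ ->]; rewrite /G foldl_rcons -/(G _) /= G1.
by have [_ _ ->] := rpathP v.
Qed.

(** * The table computes alpha_es *)

(** The typings that come from ESI-sets, as local conditions. The first clause gives independence
    and also keeps R-vertices away from S-vertices. *)
Definition proper (c : T -> vtype) : Prop :=
  [/\ forall v u, c v = tS -> e v u -> c u = tN,
      forall v, c v = tN -> exists2 u, e v u & c u = tS
    & forall v, c v = tN -> exists2 u, e v u & c u = tR].

Definition esi_type (B : {set T}) (v : T) : vtype :=
  if v \in B then tS else if v \in closed_nbhd e B then tN else tR.

Lemma ESI_proper B : ESI e B -> proper (esi_type B).
Proof.
move=> /andP[/forall_inP indB /forall_inP extB]; split=> v.
- move=> u; rewrite /esi_type; case: ifP => [vB _ vu|_]; last by case: ifP.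
  case: ifPn => [uB|_]; first by have /forall_inP/(_ u uB) := indB v vB; rewrite vu.
  by rewrite inE; case: exists_inP => // -[]; exists v; rewrite // vu orbT.
- rewrite /esi_type; case: ifPn => // vNB; case: ifPn => //.
  rewrite inE => /exists_inP[b bB /predU1P[vb|bv]] _.
    by rewrite vb bB in vNB.
  by exists b; rewrite ?bB // esym.
- rewrite /esi_type; case: ifPn => // vNB; case: ifPn => // vB _.
  have /extB/existsP[u /andP[uN vu]] : v \in open_nbhd e B by rewrite inE vNB.
  exists u => //; rewrite (negbTE uN) ifN //; apply: contra uN => uB.
  by rewrite inE; apply/exists_inP; exists u; rewrite // eqxx.
Qed.

Lemma proper_ESI c : proper c -> ESI e [set v | c v == tS].
Proof.
move=> [cS cNS cNR]; apply/andP; split.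
  apply/forall_inP=> v; rewrite inE => /eqP vS; apply/forall_inP=> u.
  by rewrite inE => /eqP uS; apply/negP=> /(cS _ _ vS); rewrite uS.
apply/forall_inP=> v; rewrite !inE => /andP[vNS /exists_inP[b]].
rewrite inE => /eqP bS /predU1P[vb|bv]; first by rewrite vb bS eqxx in vNS.
have [u vu uR] := cNR v (cS _ _ bS bv).
apply/existsP; exists u; rewrite vu andbT inE; apply/exists_inP=> -[w].
rewrite inE => /eqP wS /predU1P[uw|wu]; first by rewrite -uw uR in wS.
by rewrite (cS _ _ wS wu) in uR.
Qed.

Definition S_count (c : T -> vtype) (v : T) : nat := count (fun w => c w == tS) (pre v).

Lemma S_countE c v : S_count c v = (c v == tS) + \sum_(u in Ch v) S_count c u.
Proof.
rewrite /S_count preE /= count_flatten -map_comp sumnE big_map; congr (_ + _).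
rewrite -[RHS]big_enum; apply: perm_big; apply: uniq_perm.
- by rewrite rev_uniq kids_uniq.
- exact: enum_uniq.
- by move=> u; rewrite mem_rev mem_kids mem_enum.
Qed.

Lemma S_count_root c : S_count c r = #|[set v | c v == tS]|.
Proof.
rewrite /S_count -sum1_count (perm_big _ pre_perm) big_enum_cond -sum1_card.
by apply: eq_bigl => v; rewrite !inE.
Qed.

Local Notation natE k := (EFin (Posz k)).

Lemma natE_sum v (f : T -> nat) :
  natE (\sum_(u in Ch v) f u) = (\sum_(u in Ch v) natE (f u))%E.
Proof. exact: (big_morph (fun k => natE k) (id1 := 0%E)). Qed.

Lemma natE_le m n : (natE m <= natE n)%E = (m <= n).
Proof. by rewrite lee_fin. Qed.

Variable D : table T.
Hypothesis DP : esi_table e r D.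

(** The root is treated as if below a parent of type N, matching the returned entries: such a parent
    meets neither requirement of (C) and allows every type at the root. *)
Definition parent_type (c : T -> vtype) (v : T) : vtype :=
  if parent v is Some w then c w else tN.

Lemma parent_typeE c v u : u \in Ch v -> parent_type c u = c v.
Proof. by rewrite -parentE /parent_type => /eqP ->. Qed.

Lemma proper_le_table c v :
  proper c -> (natE (S_count c v) <= D v (c v) (parent_type c v))%E.
Proof.
move=> [cS cNS cNR]; elim/leaf_up_ind: v => v IHv; rewrite S_countE.
have pE w : w \notin Ch v -> e v w -> parent_type c v = c w.
  by move=> + /edge_child; move/negbTE => -> /parent_typeE.
have Ch_le u p : u \in Ch v -> D u (c u) (c v) = p ->
    (natE (S_count c u) <= p)%E.
  by move=> uv <-; rewrite -(parent_typeE c uv) IHv.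
case cv: (c v) in Ch_le *.
- have -> : parent_type c v = tN.
    rewrite /parent_type; case pv: (parent v) => [w|] //; apply: cS cv _.
    by rewrite esym; apply: child_edge; rewrite -parentE pv.
  rewrite (esi_table_S DP) eqxx PoszD EFinD natE_sum leeD2l //.
  apply: lee_sum => u uv; apply: Ch_le => //.
  by rewrite (cS _ _ cv (child_edge uv)).
- have -> : (tN == tS) = false by apply/eqP.
  (* A neighbour of the required type is the parent or a child; if the parent has another type, it
     is a child. *)
  have nbhd x : x != tN -> (exists2 u, e v u & c u = x) ->
      (parent_type c v != x) ==> [exists u in Ch v, [ffun u => c u] u == x].
    move=> xN [u vu ux]; apply/implyP => px; apply/exists_inP; exists u.
      by apply: contraNT px => uNv; rewrite (pE u) // ux.
    by rewrite ffunE ux.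
  rewrite add0n natE_sum (esi_table_N DP).
  apply: (bigmax_sup [ffun u => c u]).
    by apply/andP; split; apply: nbhd; try exact/eqP; [exact: cNS|exact: cNR].
  by apply: lee_sum => u uv; apply: Ch_le; rewrite // ffunE.
- have -> : (tR == tS) = false by apply/eqP.
  (* Rule (B) applies because the parent of an R-vertex cannot have type S. *)
  rewrite add0n natE_sum (esi_table_R DP); last first.
    rewrite !inE /parent_type; case pv: (parent v) => [w|]; last by rewrite eqxx.
    have wv : e w v by apply: child_edge; rewrite -parentE pv.
    case cw: (c w); rewrite ?eqxx ?orbT //.
    by have := cS _ _ cw wv; rewrite cv.
  apply: lee_sum => u uv; case cu: (c u).
  - by have := cS u v cu; rewrite esym cv => /(_ (child_edge uv)).
  - by apply: le_trans (_ : D u tN tR <= _)%E; rewrite ?Ch_le ?cu // le_max lexx.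
  - by apply: le_trans (_ : D u tR tR <= _)%E; rewrite ?Ch_le ?cu // le_max lexx orbT.
Qed.

Lemma table_N_attained v p : D v tN p != -oo%E ->
  exists2 x : {ffun T -> vtype}, admissible e r v p x &
    D v tN p = (\sum_(u in Ch v) D u (x u) tN)%E.
Proof.
rewrite (esi_table_N DP); have [x Px|noP] := pickP (admissible e r v p).
  pose F (x : {ffun T -> vtype}) := (\sum_(u in Ch v) D u (x u) tN)%E.
  have F_ge y : admissible e r v p y -> (-oo <= F y)%E by rewrite leNye.
  by have [y yP ->] := eq_bigmax x _ F Px F_ge; exists y.
by rewrite big_pred0.
Qed.

Lemma table_attained x : D r x tN != -oo%E ->
  exists c, [/\ proper c, c r = x & (D r x tN <= natE (S_count c r))%E].
Proof.
move=> Dx.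
(* Fix in advance an optimal assignment to the children for every vertex of type N and every parent
   type. *)
have : forall vp : T * vtype, exists x : {ffun T -> vtype}, D vp.1 tN vp.2 != -oo%E ->
    admissible e r vp.1 vp.2 x /\
    D vp.1 tN vp.2 = (\sum_(u in Ch vp.1) D u (x u) tN)%E.
  move=> [v p] /=; have [->|/table_N_attained[y y1 y2]] := eqVneq (D v tN p) -oo%E.
    by exists [ffun=> tS].
  by exists y.
case/fin_all_exists=> X XP.
pose maxR u := if (D u tN tR <= D u tR tR)%E then tR else tN.
(* The state passed down the tree is the type of a vertex paired with the type of its parent. *)
pose F v (a : vtype * vtype) u :=
  (match a.1 with tS => tN | tN => X (v, a.2) u | tR => maxR u end, a.1).
have [g [gr gE]] := root_down_rec F (x, tN).
pose c v := (g v).1; pose q v := (g v).2.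
have cE v u : u \in Ch v ->
    c u = match c v with tS => tN | tN => X (v, q v) u | tR => maxR u end.
  by move=> uv; rewrite /c (gE v u uv).
have qE v u : u \in Ch v -> q u = c v by move=> uv; rewrite /q (gE v u uv).
have qr : q r = tN by rewrite /q gr.
have maxRE u : maxe (D u tN tR) (D u tR tR) = D u (maxR u) tR.
  by rewrite /maxR; case: (leP (D u tN tR)).
have [DS0 DR0] : (forall v p, D v tS p != -oo%E -> p = tN) /\
    (forall v p, D v tR p != -oo%E -> p \in [:: tN; tR]).
  by split=> v; have [D1 D2 D3] := esi_table_impossible DP v; case;
    rewrite ?D1 ?D2 ?D3 // ?inE ?eqxx ?orbT.
(* A finite entry equals the contribution of v plus the entries chosen for its children, so
   finiteness descends from the root. *)
have DE v : D v (c v) (q v) != -oo%E ->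
    D v (c v) (q v) = (natE (c v == tS) + \sum_(u in Ch v) D u (c u) (q u))%E.
  move=> Dv.
  case cv: (c v) Dv => Dv.
  - rewrite (DS0 _ _ Dv) (esi_table_S DP) eqxx; congr (_ + _)%E.
    by apply: eq_bigr => u uv; rewrite (cE v u uv) (qE v u uv) cv.
  - rewrite (XP (v, q v) Dv).2 (_ : (tN == tS) = false) ?add0e; last exact/eqP.
    by apply: eq_bigr => u uv; rewrite (cE v u uv) (qE v u uv) cv.
  - rewrite (esi_table_R DP) ?(DR0 v) // (_ : (tR == tS) = false) ?add0e; last exact/eqP.
    by apply: eq_bigr => u uv; rewrite (cE v u uv) (qE v u uv) cv maxRE.
have Dfin v : D v (c v) (q v) != -oo%E.
  elim/root_down_ind: v => [|v u uv Dv]; first by rewrite /c /q gr.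
  apply/eqP=> Du; move: (Dv); rewrite (DE v Dv) => /negP[].
  rewrite adde_eq_ninfty esum_eqNy; apply/orP; right.
  by apply/exists_inP; exists u; rewrite // Du.
have qS v : c v = tS -> q v = tN by move=> cv; apply: (DS0 v); rewrite -cv Dfin.
(* A requirement waived because the parent type is [a] is met by an actual parent: at the root the
   parent type is N, which is not [a]. *)
have parent_q v a : c v = tN -> q v = a -> a != tN -> exists2 w, e v w & c w = a.
  have [->|/parent_ex[w vw]] := eqVneq v r; first by rewrite qr => _ ->; rewrite eqxx.
  by rewrite (qE w v vw) => _ wa _; exists w; rewrite // esym (child_edge vw).
have child_X v a : c v = tN ->
    (q v != a) ==> [exists u in Ch v, X (v, q v) u == a] ->
    a != tN -> exists2 u, e v u & c u = a.
  move=> cv /implyP Xa aN; have [qa|/Xa/exists_inP[u uv /eqP Xu]] := eqVneq (q v) a.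
    exact: (parent_q v a).
  by exists u; [exact: child_edge|rewrite (cE v u uv) cv].
exists c; split.
- split=> v.
  + move=> u cv /edge_child/orP[uv|vu]; first by rewrite (cE v u uv) cv.
    by rewrite -(qE u v vu) qS.
  + move=> cv; have := XP (v, q v); rewrite /= -{1}cv => /(_ (Dfin v))[/andP[XS _] _].
    by apply: (child_X v tS cv XS); exact/eqP.
  + move=> cv; have := XP (v, q v); rewrite /= -{1}cv => /(_ (Dfin v))[/andP[_ XR] _].
    by apply: (child_X v tR cv XR); exact/eqP.
- by rewrite /c gr.
- suff: forall v, (D v (c v) (q v) <= natE (S_count c v))%E.
    by move=> /(_ r); rewrite qr /c gr.
  elim/leaf_up_ind => v IHv; rewrite (DE v (Dfin v)) S_countE PoszD EFinD natE_sum.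
  by rewrite leeD2l //; apply: lee_sum => u uv; apply: IHv.
Qed.

Lemma esi_return_alpha : esi_return r D = natE (alpha_es e).
Proof.
have le_return x : (D r x tN <= esi_return r D)%E.
  by rewrite /esi_return !le_max; case: x; rewrite lexx ?orbT.
have ESI0 : ESI e set0.
  apply/andP; split; first by apply/forall_inP=> v; rewrite inE.
  apply/forall_inP=> v; rewrite !inE => /exists_inP[b]; by rewrite inE.
have alpha_le : (natE (alpha_es e) <= esi_return r D)%E.
  rewrite /alpha_es (bigop.bigmax_eq_arg set0) //; case: arg_maxnP => // B BE _.
  have := proper_le_table r (ESI_proper BE); rewrite S_count_root.
  rewrite /parent_type parent_root.
  have -> : [set v | esi_type B v == tS] = B.
    apply/setP=> v; rewrite inE /esi_type; case: ifP => _; first by rewrite eqxx.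
    by case: ifP => _; apply/eqP.
  by move=> B_le; apply: le_trans B_le (le_return _).
apply: le_anti; rewrite alpha_le andbT.
have [x Dx] : exists x, esi_return r D = D r x tN.
  rewrite /esi_return; case: (leP (D r tS tN)) => _; last by exists tS.
  by case: (leP (D r tN tN)) => _; [exists tR|exists tN].
(* The lower bound by [alpha_es] rules out a returned value -oo. *)
have [|c [cP _ c_le]] := @table_attained x.
  by rewrite -Dx; apply: contraTneq alpha_le => ->; rewrite leeNy_eq.
rewrite Dx (le_trans c_le) // natE_le S_count_root.
exact: leq_bigmax_cond (proper_ESI cP).
Qed.


End RootedTree.

(** * Program, tree and table combined *)

Lemma root_paths_ex (T : finType) (e : rel T) (r : T) : is_tree e ->
  exists rpath : T -> seq T, forall u,
    [/\ path e r (rpath u), uniq (r :: rpath u) & last r (rpath u) = u].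
Proof.
move=> [econn _]; apply: (@fin_all_exists _ _
  (fun u p => [/\ path e r p, uniq (r :: p) & last r p = u])) => u.
have /connectP[p pp ->] := econn r u.
by case/shortenP: pp => q pq uq _; exists q.
Qed.

(* 24 + 9 arrays, each touched below index 100 * 3n + 1. *)
Definition esi_space : nat := 33 * 301.
Definition esi_word : nat := 100 * 3.

Theorem theorem22 :
  exists (P : cmd) (c : nat),
  forall (T : finType) (e : rel T) (r : T) (adj : T -> seq T),
    symmetric e -> irreflexive e -> is_tree e -> adjacency_lists e adj ->
    exists (D : table T) (s : seq T) (t : seq event) (st : state),
      [/\ esi_table e r D /\ postorder e r r s,
          exec P (input adj r) t st /\
            [seq ev <- t | logged ev] = algorithm_log D s,
          esi_return r D = EFin (Posz (alpha_es e)) /\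
            st out_arr 0 = alpha_es e &
          [/\ run_time t <= c * #|T|, run_space t <= c * #|T| &
              max_word t <= c * #|T|]].
Proof.
exists esi_program, (esi_time + (esi_space + esi_word)) => T e r adj esym eirr etree adjP.
have [rpath rpathP] := root_paths_ex r etree.
have [pre preE] : exists pre : T -> seq T,
    forall v, pre v = v :: flatten [seq pre u | u <- rev (kids e r adj v)].
  apply: (child_rec esym eirr etree rpathP
    (F := fun f v => v :: flatten [seq f u | u <- rev (kids e r adj v)]) [::]) => f g v fg.
  congr (_ :: flatten _); apply/eq_in_map => u.
  by rewrite mem_rev (mem_kids esym eirr etree rpathP adjP) => /fg.
have parE := parentE esym eirr etree rpathP.
set s := rev (pre r).
(* The children in the order in which the machine processes them, so that the rows agree with the
   accumulators literally. *)
pose kl v := [seq u <- s | parent e r u == Some v].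
have pre_rP := pre_perm esym eirr etree rpathP adjP preE.
have s_uniq : uniq s by rewrite rev_uniq (perm_uniq pre_rP) enum_uniq.
have mem_kl v u : (u \in kl v) = (u \in children e r v).
  by rewrite mem_filter parE mem_rev (perm_mem pre_rP) mem_enum andbT.
have [d dE] : exists d : T -> row, forall v, d v = row_of (map d (kl v)).
  apply: (child_rec esym eirr etree rpathP
    (F := fun f v => row_of (map f (kl v))) (fun _ _ => 0)) => f g v fg.
  by congr row_of; apply/eq_in_map => u; rewrite mem_kl => /fg.
have kidsE v : kids e r adj v = [seq u <- adj v | parent e r u == Some v].
  by apply: eq_filter => u; rewrite parE.
have size_pre_kl v : size (pre v) = (\sum_(u <- kl v) size (pre u)).+1.
  rewrite (size_pre preE); congr _.+1; apply: perm_big.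
  apply: uniq_perm => [||u]; [exact: kids_uniq|exact: filter_uniq|].
  by rewrite mem_kl (mem_kids esym eirr etree rpathP adjP).
have size_pre_le v : size (pre v) <= #|T|.
  have /card_uniqP <- := pre_uniq esym eirr etree rpathP adjP preE v.
  exact: max_card.
have d_le v x p : d v x p <= (size (pre v)).+1.
  elim/(leaf_up_ind esym eirr etree rpathP): v x p => v IHv x p.
  rewrite dE size_pre_kl; apply: row_of_le => u; rewrite mem_kl => uv y q.
  exact: IHv.
have sum_pre o : \sum_(u <- s | parent e r u == o) size (pre u) <= #|T|.
  (* Below a vertex the sum is its subtree size less one; for the dummy parent only the root
     contributes, with at most n. *)
  case: o => [v|]; first by rewrite -big_filter -ltnS -size_pre_kl ltnW ?ltnS.
  rewrite (perm_big (enum T)) ?perm_rev //= big_enum_cond (big_pred1 r) // => u.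
  apply/eqP/eqP => [pu|->]; last exact: (parent_root esym eirr etree rpathP).
  apply/eqP/negPn/negP => /(parent_ex esym eirr etree rpathP)[v].
  by rewrite -parE pu.
have adj_parent v u : u \in adj v -> (parent e r v == Some u) = (parent e r u != Some v).
  rewrite (adjP v).2 !parE => vu.
  have := edge_child esym eirr etree rpathP vu.
  case: (boolP (u \in _)) => /= [uv _|_ ->] //.
  exact/negbTE/(child_asym esym eirr etree rpathP).
have before s1 v s2 u : s = s1 ++ v :: s2 -> parent e r u == Some v -> u \in s1.
  by rewrite parE; apply: (children_before esym eirr etree rpathP adjP preE).
have parR := parent_root esym eirr etree rpathP.
have sum_adj := sum_size_adj esym eirr etree rpathP adjP preE.
have preE' v : pre v = v :: flatten [seq pre u | u <- rev [seq u <- adj v | parent e r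
  u == Some v]].
  by rewrite {1}preE kidsE.
have := esi_program_runs parR adj_parent preE' pre_rP sum_adj dE before d_le sum_pre.
move=> [t [st [ex tk wr lgt out_eq]]].
pose D : table T := fun v x p => uncode (d v x p).
have DP : esi_table e r D.
  by apply: esi_table_uncode dE => // v; rewrite filter_uniq.
have ret := esi_return_alpha esym eirr etree rpathP adjP preE DP.
have n0 : 0 < #|T| by apply/card_gt0P; exists r.
have M0 : 0 < 3 * #|T| by rewrite muln_gt0.
have cells : cells_le (3 * #|T|) (input adj r) by exact: inp_le pre_rP sum_adj.
have [_ t_ok] := exec_ok M0 ex esi_program_ok cells wr.
have space_le : (24 + 9) * (100 * (3 * #|T|)).+1 <= esi_space * #|T|.
  by rewrite /esi_space; move: #|T| n0 => n; lia.
have word_le : 100 * (3 * #|T|) <= esi_word * #|T| by rewrite mulnA.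
have c_le (a b c : nat) : [/\ a * #|T| <= (a + (b + c)) * #|T|,
    b * #|T| <= (a + (b + c)) * #|T| & c * #|T| <= (a + (b + c)) * #|T|].
  by rewrite !leq_mul2r; split; lia.
have [time_c space_c word_c] := c_le esi_time esi_space esi_word.
have t_le := leq_trans tk (esi_program_cost_le pre_rP sum_adj).
exists D, s, t, st; split; split.
- exact: DP.
- exact: (postorder_pre esym eirr etree rpathP adjP preE).
- exact: ex.
- exact: lgt.
- exact: ret.
(* The code of [alpha_es e] is its successor, which the predecessor in [out_eq] undoes. *)
- rewrite out_eq; have : uncode (maxn (d r tS tN) (maxn (d r tN tN) (d r tR tN))) =
    EFin (Posz (alpha_es e)) by rewrite !uncode_max.
  by move=> /(congr1 (@Defs.code)); rewrite uncodeK => ->.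
- exact: leq_trans t_le time_c.
- exact: leq_trans (run_space_le t_ok) (leq_trans space_le space_c).
- exact: leq_trans (max_word_le t_ok) (leq_trans word_le word_c).
Qed.
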